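(* Let $0\le k<n$, $W\in\mathrm{Gr}_{k+1,n}^{>0}$, and let $w^{(0)},w^{(1)},\dots,w^{(k)}$ be a basis of $W$ such that $V:=\mathrm{span}(w^{(1)},\dots,w^{(k)})\in\mathrm{Gr}_{k,n}^{>0}$ and $w^{(0)}$ is positively oriented with respect to $V$. Let $\mathcal{H}^W$, $\psi_{\mathcal{H}^W}$, $\Psi_{\mathcal{H}^W}$ and $B(\mathcal{H}^W)$ be as in the context. Then the restriction of $\Psi_{\mathcal{H}^W}$ to $B(\mathcal{H}^W)$ is a homeomorphism from $B(\mathcal{H}^W)$ onto $\mathcal{B}_{n,k,1}(W)$, and it induces an isomorphism of posets between the strata of $B(\mathcal{H}^W)$ (its bounded faces) and the strata of $\mathcal{B}_{n,k,1}(W)$ (each ordered by containment of closures). Explicitly, $\Psi_{\mathcal{H}^W}$ sends the face $\psi_{\mathcal{H}^W}^{-1}(\sigma)$ of $B(\mathcal{H}^W)$ onto $\mathcal{B}_\sigma(W)$ for every $\sigma\in\overline{\mathrm{Sign}_{n,k,1}}$.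
   Context: $\mathrm{Gr}_{k,n}$ is the real Grassmannian; $\mathrm{Gr}_{k,n}^{\ge0}$ (resp. $\mathrm{Gr}_{k,n}^{>0}$) consists of subspaces whose Plücker coordinates are all $\ge0$ (resp. all $>0$) for a suitable representative. For $v\in\mathbb{R}^n$, $\mathrm{var}(v)$ is the number of sign changes of $v_1,\dots,v_n$ ignoring zeros ($\mathrm{var}(0)=-1$), and $\overline{\mathrm{var}}(v)=\max\{\mathrm{var}(w): w_i=v_i \text{ whenever } v_i\neq0\}$; the same definitions apply to sign vectors in $\{0,+,-\}^n$, and $\mathrm{sign}(v)$ is the componentwise sign. Positive orientation: if $V\in\mathrm{Gr}_{k,n}^{>0}$ and $w\notin V$ with $V+\mathbb{R}w\in \mathrm{Gr}_{k+1,n}^{>0}$, let $U:=V^\perp\cap(V+\mathbb{R}w)$ (a line) and let $u\in U$ with $w-u\in V$. Then $u_1\neq0$; $w$ is called positively oriented with respect to $V$ if $u_1>0$. Hyperplane arrangement: $\mathcal{H}^W$ is the arrangement in $\mathbb{R}^k$ of the hyperplanes $H_i=\{x\in\mathbb{R}^k: w^{(1)}_ix_1+\cdots+w^{(k)}_ix_k+w^{(0)}_i=0\}$, $i\in[n]$. Define $\psi_{\mathcal{H}^W}(x):=\mathrm{sign}(x_1w^{(1)}+\cdots+x_kw^{(k)}+w^{(0)})\in\{0,+,-\}^n$ and $\Psi_{\mathcal{H}^W}(x):=\langle x_1w^{(1)}+\cdots+x_kw^{(k)}+w^{(0)}\rangle\in\mathbb{P}(W)$. The faces of $\mathcal{H}^W$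 are the nonempty fibers $\psi_{\mathcal{H}^W}^{-1}(\sigma)$ (the face labeled by $\sigma$). $B(\mathcal{H}^W)$ is the complex (union) of bounded faces. $\overline{\mathrm{Sign}_{n,k,1}}$ is the set of nonzero $\sigma\in\{0,+,-\}^n$ with $\overline{\mathrm{var}}(\sigma)=k$ such that, if $i$ is the index of the first nonzero component, then $\sigma_i=(-1)^{i-1}$. $\mathcal{B}_{n,k,1}(W):=\{V'^\perp\cap W: V'\in\mathrm{Gr}_{k,n}^{\ge0}\}\subseteq\mathbb{P}(W)$ (each $V'^\perp\cap W$ is a line); for nonzero $\sigma$ with $\overline{\mathrm{var}}(\sigma)=k$, its stratum is $\mathcal{B}_\sigma(W):=\{\langle w\rangle: w\in W\setminus\{0\},\ \mathrm{sign}(w)=\pm\sigma\}$. *)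

(* Defs.v *)
From HB Require Import structures.
From mathcomp Require Import all_boot all_order all_algebra.
From mathcomp Require Import all_classical all_reals all_analysis.
Set Implicit Arguments.
Unset Strict Implicit.
Unset Printing Implicit Defensive.
Import Order.TTheory GRing.Theory Num.Theory.
Import numFieldNormedType.Exports.
Local Open Scope classical_set_scope.
Local Open Scope ring_scope.

Inductive sgn : predArgType := Zero | Pos | Neg.

Definition sgn_code (s : sgn) : option bool :=
  match s with Zero => None | Pos => Some true | Neg => Some false end.
Definition sgn_decode (o : option bool) : sgn :=
  match o with None => Zero | Some true => Pos | Some false => Neg end.
Lemma sgn_codeK : cancel sgn_code sgn_decode. Proof. by case. Qed.
HB.instance Definition _ := Finite.copy sgn (can_type sgn_codeK).

Definition sgn_opp (s : sgn) : sgn :=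
  match s with Zero => Zero | Pos => Neg | Neg => Pos end.

Notation signvec n := {ffun 'I_n -> sgn}.

Definition signvec0 n : signvec n := [ffun=> Zero].
Definition signvec_opp n (s : signvec n) : signvec n :=
  [ffun i => sgn_opp (s i)].

Definition sgn_of (R : realType) (x : R) : sgn :=
  if x == 0 then Zero else if 0 < x then Pos else Neg.
Definition sign (R : realType) n (v : 'rV[R]_n) : signvec n :=
  [ffun i => sgn_of (v 0 i)].

Definition var n (s : signvec n) : int :=
  if [seq x <- [seq s i | i <- enum 'I_n] | x != Zero] is x :: t
  then (sumn (pairmap (fun y z => (y != z) : nat) x t))%:Z else -1.

(* The default value -1 of the maximum is a lower bound of var. *)
Definition ovar n (s : signvec n) : int :=
  \big[Order.max/(-1)]_(t : signvec n |
    [forall i, (s i != Zero) ==> (t i == s i)]) var t.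

(* With 0-based indices, (-1)^(i-1) for the i-th component is + iff i is
   even. *)
Definition Sign_bar n (k : nat) : set (signvec n) :=
  [set s | [/\ s <> signvec0 n, ovar s = k%:Z &
    forall i : 'I_n, s i != Zero ->
      (forall j : 'I_n, (j < i)%N -> s j = Zero) ->
      s i = if odd i then Neg else Pos]].

Section Grassmannian.
Variables (R : realType) (n : nat).
Implicit Types V W : {vspace 'rV[R]_n}.

Definition represents k (A : 'M[R]_(k, n)) V : Prop :=
  row_free A /\ V = <<[seq row i A | i : 'I_k]>>%VS.

(* The k-subsets of the columns are given by their increasing enumerations. *)
Definition Gr_nonneg k V : Prop :=
  exists2 A : 'M[R]_(k, n), represents A V &
    forall f : 'I_k -> 'I_n, {homo f : i j / (i < j)%N} ->
      0 <= \det (colsub f A).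

Definition Gr_pos k V : Prop :=
  exists2 A : 'M[R]_(k, n), represents A V &
    forall f : 'I_k -> 'I_n, {homo f : i j / (i < j)%N} ->
      0 < \det (colsub f A).

Definition dotv (u v : 'rV[R]_n) : R := \sum_i u 0 i * v 0 i.

Definition orthv V : {vspace 'rV[R]_n} :=
  lker (linfun (mulmxr (\matrix_(i < \dim V) (vbasis V)`_i)^T)).

Lemma orthvP V v :
  reflect (forall u, u \in V -> dotv u v = 0) (v \in orthv V).
Proof.
have dotE u : dotv u v = (v *m u^T) 0 0.
  by rewrite mxE; apply: eq_bigr => i _; rewrite mxE mulrC.
rewrite memv_ker lfunE /=; apply: (iffP eqP) => [v0 u uV|v0].
  rewrite dotE (coord_vbasis uV) linear_sum mulmx_sumr summxE big1// => i _.
  rewrite linearZ /= -scalemxAr mxE [X in _ * X](_ : _ = 0) ?mulr0//.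
  move/matrixP: v0 => /(_ 0 i); rewrite !mxE => v0i.
  by rewrite -[RHS]v0i; apply: eq_bigr => j _; rewrite !mxE.
apply/rowP => i; rewrite !mxE -[RHS](v0 (vbasis V)`_i).
  by apply: eq_bigr => j _; rewrite !mxE mulrC.
by apply: vbasis_mem; rewrite mem_nth// size_tuple.
Qed.

End Grassmannian.

(* u is the orthogonal projection of w to the orthogonal complement of V, so
   it exists and is unique. *)
Definition positively_oriented (R : realType) n (V : {vspace 'rV[R]_n.+1})
    (w : 'rV[R]_n.+1) : Prop :=
  exists u : 'rV[R]_n.+1,
    [/\ u \in (orthv V :&: (V + <[w]>))%VS, w - u \in V & 0 < u 0 ord0].

Definition projsp (R : realType) (n : nat) : Type :=
  {L : {vspace 'rV[R]_n.+1} | \dim L == 1%N}.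

Section ProjectiveSpace.
Variables (R : realType) (n : nat).
Local Notation P := (projsp R n).

HB.instance Definition _ := Choice.on P.

Definition cone (U : set P) : set 'rV[R]_n.+1 :=
  [set v | exists2 L : P, U L & val L = <[v]>%VS].

(* Quotient topology of v |-> <[v]> on the nonzero vectors; these form an open
   subset of the space of all vectors. *)
Definition proj_open : set_system P := [set U | open (cone U)].

Lemma dim_line (v : 'rV[R]_n.+1) : v != 0 -> \dim <[v]> == 1%N.
Proof. by rewrite dim_vline => ->. Qed.

Lemma cone_neq0 U v : cone U v -> v != 0.
Proof.
move=> [L _ Lv]; apply/eqP => v0; have := valP L.
by rewrite Lv v0 dim_vline eqxx.
Qed.

Lemma proj_openT : proj_open setT.
Proof.
rewrite /proj_open /= [X in open X](_ : _ = ~` [set 0]).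
  by apply: closed_openC; exact/accessible_closed_set1/hausdorff_accessible/
    norm_hausdorff.
apply/seteqP; split=> v /= => [/cone_neq0/eqP//|/eqP v0].
by exists (exist _ <[v]>%VS (dim_line v0)).
Qed.

Lemma proj_openI A B : proj_open A -> proj_open B -> proj_open (A `&` B).
Proof.
rewrite /proj_open /= => oA oB.
rewrite [X in open X](_ : _ = cone A `&` cone B); first exact: openI.
apply/seteqP; split=> v /=; first by move=> [L [AL BL] Lv]; split; exists L.
move=> [[L AL Lv] [L' BL L'v]]; exists L => //; split=> //.
by suff -> : L = L' by []; apply: val_inj; rewrite /= Lv L'v.
Qed.

Lemma proj_open_bigU (I : Type) (f : I -> set P) :
  (forall i, proj_open (f i)) -> proj_open (\bigcup_i f i).
Proof.
rewrite /proj_open /= => of_.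
rewrite [X in open X](_ : _ = \bigcup_i cone (f i)).
  by apply: bigcup_open => i _; exact: of_.
apply/seteqP; split=> v /=; first by move=> [L [i _ fL] Lv]; exists i => //; exists L.
by move=> [i _ [L fL Lv]]; exists L => //; exists i.
Qed.

HB.instance Definition _ :=
  isOpenTopological.Build P proj_openT proj_openI proj_open_bigU.

Lemma const1_neq0 : const_mx 1 != 0 :> 'rV[R]_n.+1.
Proof.
by apply/eqP => /rowP/(_ ord0)/eqP; rewrite !mxE (negbTE (oner_neq0 R)).
Qed.

(* <[v]> as a point of the projective space, with a junk value at v = 0. *)
Definition line (v : 'rV[R]_n.+1) : P :=
  insubd (exist _ <[const_mx 1]>%VS (dim_line const1_neq0) : P) <[v]>%VS.

Lemma val_line v : v != 0 -> val (line v) = <[v]>%VS.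
Proof. by move=> v0; rewrite /line val_insubd dim_line. Qed.

End ProjectiveSpace.

Section Arrangement.
Variables (R : realType) (n k : nat) (w : 'I_k.+1 -> 'rV[R]_n.+1).

(* The span of w^(1), ..., w^(k). *)
Definition dirspan : {vspace 'rV[R]_n.+1} :=
  <<[seq w (lift ord0 i) | i : 'I_k]>>%VS.

Definition affcomb (x : 'rV[R]_k) : 'rV[R]_n.+1 :=
  \sum_(i < k) x 0 i *: w (lift ord0 i) + w ord0.

Definition psi (x : 'rV[R]_k) : signvec n.+1 := sign (affcomb x).

Definition Psi (x : 'rV[R]_k) : projsp R n := line (affcomb x).

Definition face (s : signvec n.+1) : set 'rV[R]_k := psi @^-1` [set s].

Definition bounded_faces : set (set 'rV[R]_k) :=
  [set F | [/\ exists s, F = face s, F !=set0 & bounded_set F]].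

Definition bounded_complex : set 'rV[R]_k := \bigcup_(F in bounded_faces) F.

End Arrangement.

Section Amplituhedron.
Variables (R : realType) (n k : nat) (W : {vspace 'rV[R]_n.+1}).

Definition amplituhedron : set (projsp R n) :=
  [set L | exists2 V' : {vspace 'rV[R]_n.+1}, Gr_nonneg k V' &
    val L = (orthv V' :&: W)%VS].

Definition stratum (s : signvec n.+1) : set (projsp R n) :=
  [set L | exists v : 'rV[R]_n.+1,
    [/\ v \in W, v != 0, sign v = s \/ sign v = signvec_opp s
      & val L = <[v]>%VS]].

Definition strata : set (set (projsp R n)) :=
  [set S | exists s : signvec n.+1,
    [/\ s <> signvec0 n.+1, ovar s = k%:Z & S = stratum s]].

End Amplituhedron.

Definition homeomorphism_on (T U : topologicalType) (A : set T) (B : set U)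
    (f : T -> U) : Prop :=
  [/\ set_bij A B f, {within A, continuous f} &
    exists2 g : U -> T, {within B, continuous g} & {in A, cancel f g}].

(* f is an isomorphism between the families X and Y of sets, both ordered by
   containment of closures. *)
Definition closure_poset_iso (T U : topologicalType) (X : set (set T))
    (Y : set (set U)) (f : set T -> set U) : Prop :=
  set_bij X Y f /\
  forall F G, X F -> X G ->
    (closure F `<=` closure G <-> closure (f F) `<=` closure (f G)).

(* Main.v *)
Require Import Defs.
From HB Require Import structures.
From mathcomp Require Import all_boot all_order all_algebra.
From mathcomp Require Import all_classical all_reals all_analysis.
From mathcomp Require Import zify ring lra.
Set Implicit Arguments.
Unset Strict Implicit.
Unset Printing Implicit Defensive.
Import Order.TTheory GRing.Theory Num.Theory.
Import numFieldNormedType.Exports.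
Local Open Scope classical_set_scope.
Local Open Scope ring_scope.

(* For a sign vector s of length N, search greedily for a longest subsequence
   that weakly alternates +, -, +, ... (or -, +, -, ...). The positions not
   selected carry exactly the opposite of the sign waited for, so the two
   lengths determine ovar s, differ by one when s is nonzero, and the larger one
   is read off the first nonzero sign.

   Gantmakher and Krein: if V is totally positive of dimension k, the sign
   vectors of V \ {0} are the nonzero s with ovar s < k; a nonzero vector
   orthogonal to a totally nonnegative V' of dimension k has ovar >= k, and
   conversely every z with ovar z >= k is orthogonal to some such V'. Hence the
   points of B_{n,k,1}(W) are the lines spanned by the z in W with ovar z = k;
   such z are not in V, so that they can be rescaled to lie in w^(0) + V, the
   image of the arrangement.

   Let B be a positive matrix of V. Positive orientation says that the maximal
   minors of (z; B), which do not depend on z in w^(0) + V, are positive. When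
   ovar z = k, expanding such a minor along a weakly alternating subsequence of
   length k + 1 shows that this subsequence starts with + (so that the sign of
   z is in Sign_bar) and bounds the entries of z in terms of sign z only: the
   face of z is bounded. When ovar z < k, some vector of V has the same sign as
   z and is a recession direction of the face. *)

(** * Greedy selection of weakly alternating subsequences *)

Section Counting.
Local Open Scope nat_scope.
Implicit Types (P Q : pred nat) (s t : nat -> sgn) (e : bool).

Definition cnt P i := count P (iota 0 i).

Lemma cntS P i : cnt P i.+1 = cnt P i + P i.
Proof. by rewrite /cnt -addn1 iotaD count_cat /= addn0 add0n. Qed.

Lemma cnt_mono P i j : i <= j -> cnt P i <= cnt P j.
Proof.
elim: j => [|j IH]; first by rewrite leqn0 => /eqP->.
rewrite leq_eqVlt => /predU1P[->//|]; rewrite ltnS cntS => /IH; lia.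
Qed.

Lemma eq_cnt P Q i : (forall j, j < i -> P j = Q j) -> cnt P i = cnt Q i.
Proof.
elim: i => // i IH PQ; rewrite !cntS PQ// IH// => j ji.
by rewrite PQ// ltnW.
Qed.

Lemma cnt_jump P m j : j < cnt P m -> exists i, [/\ i < m, P i & cnt P i = j].
Proof.
elim: m => [//|m IH]; rewrite cntS => jm.
case: (ltnP j (cnt P m)) => [/IH[i [im Pi <-]]|mj].
  by exists i; split=> //; apply: ltnW.
by exists m; case: (P m) jm => jm; split=> //; lia.
Qed.

Lemma cnt_sub P Q i : (forall j, j < i -> P j -> Q j) -> cnt P i <= cnt Q i.
Proof.
elim: i => // i IH PQ; rewrite !cntS leq_add//.
  by apply: IH => j ji; apply: PQ; apply: ltnW.
by have := PQ i (leqnn _); case: (P i) => // ->.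
Qed.

Lemma cnt_sub_eq P Q m : (forall j, j < m -> P j -> Q j) ->
  cnt Q m <= cnt P m -> forall j, j < m -> P j = Q j.
Proof.
elim: m => // m IH PQ; rewrite !cntS => le j.
have PQ' j' : j' < m -> P j' -> Q j' by move=> /ltnW/PQ.
have H := cnt_sub PQ'; have PQm := PQ m (leqnn _).
rewrite ltnS leq_eqVlt => /predU1P[->|jm].
  by case: (P m) (Q m) PQm le => [] [] //=; [move=> /(_ isT)|lia].
by apply: IH => //; case: (P m) (Q m) PQm le => [] [] //=; try lia; move=> /(_ isT).
Qed.

(** [cnt P] grows by at most one at each position, so every rank below [k] is attained at an element
    of [P]. *)
Lemma cnt_enum n P k : cnt P n.+1 = k -> exists h : 'I_k -> 'I_n.+1,
  [/\ {homo h : i j / (i < j)%N}, forall j, P (h j) & forall j, cnt P (h j) = j].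
Proof.
move=> Pk; have H (j : 'I_k) : exists i : 'I_n.+1, P i && (cnt P i == j).
  have := ltn_ord j; rewrite -[X in _ < X]Pk => /cnt_jump[i [im Pi <-]].
  by exists (Ordinal im); rewrite Pi /=.
exists (fun j => xchoose (H j)); split=> [i j ij|j|j].
- case/andP: (xchooseP (H i)) => _ /eqP ci; case/andP: (xchooseP (H j)) => _ /eqP cj.
  by rewrite ltnNge; apply/negP => /(cnt_mono P); rewrite ci cj leqNgt ij.
- by case/andP: (xchooseP (H j)).
- by case/andP: (xchooseP (H j)) => _ /eqP.
Qed.

Lemma cnt_lt_enum n P k : k <= cnt P n.+1 -> exists h : 'I_k -> 'I_n.+1,
  [/\ {homo h : i j / (i < j)%N}, forall j, P (h j) & forall j, cnt P (h j) = j].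
Proof.
move=> Pk; have [h [h1 h2 h3]] := cnt_enum (erefl (cnt P n.+1)).
exists (fun j => h (widen_ord Pk j)); split=> [i j ij|j|j]; last by rewrite h3.
  by apply: h1.
exact: h2.
Qed.

(** The sign of [(-1)^(e + c)], awaited once [c] entries of an alternation starting with [(-1)^e]
    have been selected. *)
Definition req e c : sgn := if e (+) odd c then Neg else Pos.

Lemma req_negb e c : req (~~ e) c = sgn_opp (req e c).
Proof. by rewrite /req; case: e; case: (odd c). Qed.

Lemma reqS e c : req e c.+1 = sgn_opp (req e c).
Proof. by rewrite /req /=; case: e; case: (odd c). Qed.

Lemma req_neq0 e c : req e c != Zero.
Proof. by rewrite /req; case: ifP. Qed.

Lemma sgn_opp_neq e c : (sgn_opp (req e c) == req e c) = false.
Proof. by rewrite /req; case: ifP. Qed.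

Lemma req_inj e e' c : req e c = req e' c -> e = e'.
Proof. by rewrite /req; case: e; case: e'; case: (odd c). Qed.

Definition allowed e c (x : sgn) := (x == Zero) || (x == req e c).

Lemma not_allowed e c x : ~~ allowed e c x -> x = req (~~ e) c.
Proof. by rewrite /allowed /req; case: x; case: e; case: (odd c). Qed.

(* The length of the longest subsequence of s_0, ..., s_(i-1) whose nonzero
   entries agree with (-1)^e, -(-1)^e, (-1)^e, ..., found greedily. *)
Fixpoint wcount e s i :=
  if i is j.+1 then wcount e s j + allowed e (wcount e s j) (s j) else 0.

Definition wsel e s : pred nat := fun i => allowed e (wcount e s i) (s i).

Lemma wcountE e s i : wcount e s i = cnt (wsel e s) i.
Proof. by elim: i => // i IH; rewrite cntS -IH. Qed.

Lemma eq_wcount e s t i : (forall j, j < i -> s j = t j) ->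
  wcount e s i = wcount e t i.
Proof.
elim: i => // i IH st /=; rewrite st// IH// => j ji.
by rewrite st// ltnW.
Qed.

Lemma wcount_opp e s i :
  wcount e (fun j => sgn_opp (s j)) i = wcount (~~ e) s i.
Proof.
elim: i => // i IH /=; rewrite IH; congr (_ + nat_of_bool _).
by rewrite /allowed req_negb /req; case: (s i); case: (_ (+) _).
Qed.

(** While the two counts agree, an entry allowed for [t] is also allowed for [s]; a count that lags
    behind gains at most one per step, so it cannot overtake. *)
Lemma wcount_refine e s t i : (forall j, j < i -> s j != Zero -> t j = s j) ->
  wcount e t i <= wcount e s i.
Proof.
elim: i => // i IH st /=.
have /IH : forall j, j < i -> s j != Zero -> t j = s j by move=> j /ltnW; apply: st.
rewrite leq_eqVlt => /predU1P[->|]; last by case: allowed; case: allowed; lia.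
rewrite leq_add2l; have := st i (leqnn _); rewrite /allowed.
by case: (s i) => [_|/(_ isT)->|/(_ isT)->]; rewrite ?leq_b1.
Qed.

Lemma wcount0 e s i : (forall j, j < i -> s j = Zero) -> wcount e s i = i.
Proof.
elim: i => // i IH s0 /=; rewrite /allowed s0// IH ?addn1// => j ji.
by rewrite s0// ltnW.
Qed.

(* After the first nonzero entry, both greedy searches wait for the same sign. *)
Lemma wcount_first e s p m : (forall j, j < p -> s j = Zero) -> p < m ->
  s p = req e p -> wcount e s m = (wcount (~~ e) s m).+1.
Proof.
move=> s0 pm sp; elim: m pm => // m IH; rewrite ltnS leq_eqVlt => /predU1P[<-|].
  rewrite /= !wcount0// sp /allowed req_negb eqxx orbT (negbTE (req_neq0 _ _)) /=.
  by rewrite eq_sym sgn_opp_neq; lia.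
move=> /IH; rewrite /= => ->; rewrite /allowed reqS req_negb.
by case: (s m == _); case: (s m == _); lia.
Qed.

Lemma wcount_diff s m : (exists2 j, j < m & s j != Zero) ->
  exists e, wcount e s m = (wcount (~~ e) s m).+1.
Proof.
move=> [j jm sj]; have ex : exists j, s j != Zero by exists j.
case: (ex_minnP ex) => p sp minp.
have s0 j' : j' < p -> s j' = Zero.
  by move=> j'p; apply/eqP; apply/negP => /negP /minp; rewrite leqNgt j'p.
have [e se] : exists e, s p = req e p.
  rewrite /req; case: (s p) sp => // _; [exists (odd p)|exists (~~ odd p)];
  by case: (odd p).
by exists e; apply: (wcount_first s0) => //; apply: leq_ltn_trans (minp _ sj) jm.
Qed.

(** Strict counterpart of [wcount]: zeros are not selected, and the search starts with [c] entries
    already chosen. *)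
Definition scount e := foldl (fun c x => c + (x == req e c)).

(** When the letter [x] just read is not the awaited sign, the next selected letter is the next one
    different from [x], so the search counts the sign changes. *)
Lemma scount_pairmap e c x l : all (fun y => y != Zero) l -> x != Zero ->
  x != req e c -> scount e c l = c + sumn (pairmap (fun y z => (y != z) : nat) x l).
Proof.
elim: l c x => [|y l IH] c x /=; first by rewrite addn0.
case/andP=> y0 l0 x0 xc; have [->|yx] := eqVneq y x.
  by rewrite (negbTE xc) addn0 (IH _ x).
have yc : y = req e c.
  by case: y y0 yx {IH} => //; case: x x0 xc => //; rewrite /req; case: ifP.
by rewrite [RHS]addnA yc eqxx (IH _ (req e c))// ?req_neq0// addn1 reqS eq_sym
  sgn_opp_neq.
Qed.

Lemma scount_filter e c l :
  scount e c [seq x <- l | x != Zero] = scount e c l.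
Proof.
elim: l c => //= x l IH c; case: eqVneq => [->|_] /=; rewrite IH//.
by rewrite eq_sym (negbTE (req_neq0 _ _)) addn0.
Qed.

Lemma scount_le_wcount e s t i : (forall j, j < i -> s j != Zero -> t j = s j) ->
  scount e 0 [seq t j | j <- iota 0 i] <= wcount e s i.
Proof.
elim: i => // i IH st.
have /IH : forall j, j < i -> s j != Zero -> t j = s j by move=> j /ltnW; apply: st.
rewrite -[i.+1]addn1 iotaD map_cat /scount foldl_cat -/(scount _) /= addn1 /= add0n.
rewrite leq_eqVlt => /predU1P[->|]; last by case: eqP; case: allowed; lia.
rewrite leq_add2l; have := st i (leqnn _); rewrite /allowed.
by case: (s i) => [_|/(_ isT)->|/(_ isT)->]; rewrite ?leq_b1.
Qed.

(** Giving each zero the sign awaited at that moment turns a weak alternation into a strict one of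
    the same length. This shows that the bound of [scount_le_wcount] is attained. *)
Lemma scount_fill e s i :
  let t j := if s j == Zero then req e (wcount e s j) else s j in
  scount e 0 [seq t j | j <- iota 0 i] = wcount e s i.
Proof.
move=> t; elim: i => // i IH.
rewrite -[i.+1]addn1 iotaD map_cat /scount foldl_cat -/(scount _) /= addn1 /= add0n.
rewrite IH; congr (_ + nat_of_bool _); rewrite /t /allowed.
by have [_|_] := eqVneq (s i) Zero; rewrite ?eqxx.
Qed.
End Counting.

(** * Expressing [ovar] by the lengths of the two greedy searches *)

Section Variation.
Variable n : nat.
Implicit Types s t : signvec n.+1.

Definition letter s : nat -> sgn := fun i => s (inord i).
Definition wtot e s := wcount e (letter s) n.+1.

Lemma letterE s (i : 'I_n.+1) : letter s i = s i.
Proof. by rewrite /letter inord_val. Qed.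

Lemma map_letter s : [seq s i | i <- enum 'I_n.+1] = [seq letter s i | i <- iota 0 n.+1].
Proof. by rewrite -val_enum_ord -map_comp; apply: eq_map => i /=; rewrite letterE. Qed.

(** The search awaiting the first nonzero sign selects it and then one entry per sign change; the
    other search finds one entry less. For the zero vector both counts are 0, in accordance with
    [var = -1]. *)
Lemma var_scount s (l := [seq letter s i | i <- iota 0 n.+1]) :
  var s + 1 = (maxn (scount false 0 l) (scount true 0 l))%:Z.
Proof.
rewrite /var map_letter -/l -![in RHS](scount_filter _ _ l).
have : all (fun y => y != Zero) [seq x <- l | x != Zero] by apply: filter_all.
case: [seq x <- l | x != Zero] => [//|x t] /andP[x0 t0].
have E e : scount e 0 (x :: t) = scount e (0 + (x == req e 0))%N t by [].
by rewrite !E; case: x x0 {E} => // x0; rewrite !(@scount_pairmap _ _ _ t t0 x0) //=; lia.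
Qed.

Lemma ovarE s : ovar s + 1 = (maxn (wtot false s) (wtot true s))%:Z.
Proof.
suff -> : ovar s = (maxn (wtot false s) (wtot true s))%:Z - 1 by rewrite subrK.
apply/eqP; rewrite eq_le; apply/andP; split.
  apply/bigmax_leP; split=> [|t /forallP st]; first lia.
  have H e : (scount e 0 [seq letter t i | i <- iota 0 n.+1] <= wtot e s)%N.
    apply: scount_le_wcount => j _; have /implyP := st (inord j).
    by move=> H /H /eqP.
  by have := var_scount t; have := H false; have := H true; lia.
have H e : (wtot e s)%:Z <= ovar s + 1.
  have le_max L : (scount e 0 L <= maxn (scount false 0 L) (scount true 0 L))%N.
    by case: e; rewrite ?leq_maxl ?leq_maxr.
  (* The completion of [s] whose variation reaches the bound for the start [e]. *)
  pose t : signvec n.+1 := [ffun i : 'I_n.+1 => if s i == Zero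
    then req e (wcount e (letter s) i) else s i].
  have tE : scount e 0 [seq letter t i | i <- iota 0 n.+1] = wtot e s.
    rewrite /wtot -(scount_fill e (letter s)); congr scount.
    apply/eq_in_map => j; rewrite mem_iota /= add0n => jn.
    by rewrite /letter ffunE inordK.
  have : var t <= ovar s.
    apply: le_bigmax_cond; apply/forallP => i; apply/implyP => si.
    by rewrite ffunE (negbTE si).
  by have := var_scount t; have := le_max [seq letter t i | i <- iota 0 n.+1]; rewrite -tE; lia.
by have := H false; have := H true; lia.
Qed.

Lemma signvec_neq0P s : s <> signvec0 n.+1 -> exists i, s i != Zero.
Proof.
move=> s0; apply/existsP; apply: contra_notT s0 => /existsPn s0.
by apply/ffunP => i; rewrite ffunE; apply/eqP; rewrite -[_ == _]negbK.
Qed.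

Lemma wtot_diff s : s <> signvec0 n.+1 ->
  exists e, wtot e s = (wtot (~~ e) s).+1.
Proof.
move=> /signvec_neq0P[i si]; apply: wcount_diff; exists (i : nat) => //.
by rewrite letterE.
Qed.

Lemma ovar_wtot s k : s <> signvec0 n.+1 -> ovar s = k%:Z ->
  exists e, wtot e s = k.+1 /\ wtot (~~ e) s = k.
Proof.
move=> s0 sk; have := ovarE s; rewrite sk => /eqP.
have [e] := wtot_diff s0; rewrite -PoszD eqz_nat => se /eqP H; exists e.
by case: e se H => /=; lia.
Qed.

Lemma wtot_ovar s k e : (forall d, wtot d s <= k.+1)%N ->
  (k.+1 <= wtot e s)%N -> ovar s = k%:Z.
Proof.
move=> le se; have := ovarE s; have := le true; have := le false.
by case: e se; lia.
Qed.

Lemma wtot_opp e s : wtot e (signvec_opp s) = wtot (~~ e) s.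
Proof.
rewrite /wtot -wcount_opp; apply: eq_wcount => j _.
by rewrite /letter ffunE.
Qed.

Lemma ovar_opp s : ovar (signvec_opp s) = ovar s.
Proof.
apply: (@addIr _ 1); rewrite !ovarE !wtot_opp /=; lia.
Qed.

(** All [p] leading zeros are selected, so at the first nonzero entry the search started with +
    awaits [(-1)^p], which is the sign prescribed by [Sign_bar]. *)
Lemma Sign_bar_wtot s k : Sign_bar k s -> wtot false s = k.+1 /\ wtot true s = k.
Proof.
move=> [s0 sk sfirst]; have [i si] := signvec_neq0P s0.
have ex : exists j, (j < n.+1)%N && (letter s j != Zero).
  by exists (i : nat); rewrite ltn_ord letterE.
case: (ex_minnP ex) => p /andP[pn sp] minp.
have z j : (j < p)%N -> letter s j = Zero.
  move=> jp; apply/eqP; apply/negP => /negP sj.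
  by have := minp j; rewrite (ltn_trans jp pn) sj leqNgt jp => /(_ isT).
have : letter s p = req false p.
  rewrite /letter (sfirst (inord p)) ?inordK//.
  by move=> j /z; rewrite letterE.
move=> /(wcount_first z pn); rewrite -!/(wtot _ s) => se.
by have := ovarE s; rewrite sk se /=; lia.
Qed.

End Variation.

(** * Maximal minors and the upper bound on the variation *)

Section Minors.
Variables (R : realType) (n : nat).
Implicit Types (v u : 'rV[R]_n.+1) (e : bool).

Definition increasing m (f : 'I_m -> 'I_n.+1) := {homo f : i j / (i < j)%N}.

Lemma increasing_inj m (f : 'I_m -> 'I_n.+1) : increasing f -> injective f.
Proof.
move=> hf i j ij; apply: val_inj; case: (ltngtP i j) => // /hf;
by rewrite ij ltnn.
Qed.

Lemma increasing_lift m (f : 'I_m.+1 -> 'I_n.+1) j :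
  increasing f -> increasing (f \o lift j).
Proof. by move=> hf i i' ii' /=; apply: hf; move: ii'; rewrite /= /bump; do 2 case: leqP; lia. Qed.

Lemma sgn_of_allowed e c (x : R) :
  allowed e c (sgn_of x) = (0 <= (-1) ^+ (e + c) * x).
Proof.
rewrite /allowed /sgn_of /req -signr_odd oddD oddb.
case: (_ (+) _); rewrite ?expr1 ?expr0 ?mulN1r ?mul1r ?oppr_ge0;
by case: (ltgtP x 0).
Qed.

Lemma letter_sign v i : letter (sign v) i = sgn_of (v 0 (inord i)).
Proof. by rewrite /letter ffunE. Qed.

Lemma letter_signE v (i : 'I_n.+1) : letter (sign v) i = sgn_of (v 0 i).
Proof. by rewrite letterE ffunE. Qed.

Lemma sign_neq0 v : v != 0 -> sign v <> signvec0 n.+1.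
Proof.
move=> /eqP v0 s0; apply: v0; apply/rowP => i; rewrite mxE.
by move/ffunP: s0 => /(_ i); rewrite !ffunE /sgn_of; case: eqP => //; case: ifP.
Qed.

(** The positions [g] are chosen from [s] before [v], so that a single minor serves all points of a
    face. *)
Lemma wtot_alternate (s : signvec n.+1) e m : (m <= wtot e s)%N ->
  exists2 g : 'I_m -> 'I_n.+1, increasing g & forall v, sign v = s ->
    forall j : 'I_m, 0 <= (-1) ^+ (e + j) * v 0 (g j).
Proof.
rewrite /wtot wcountE => /cnt_lt_enum[g [g1 g2 g3]]; exists g => // v vs j.
by rewrite -sgn_of_allowed -letter_signE vs; have := g2 j; rewrite /wsel wcountE g3.
Qed.

Lemma det_col_mx k (r : 'rV[R]_k.+1) (M : 'M[R]_(k, k.+1)) :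
  \det (col_mx r M : 'M[R]_(k.+1)) =
  \sum_(j < k.+1) (-1) ^+ j * r 0 j * \det (col' j M).
Proof.
rewrite (expand_det_row _ ord0); apply: eq_bigr => j _.
rewrite /cofactor add0n mulrA.
have -> : row' ord0 (col' j (col_mx r M : 'M[R]_(k.+1))) = col' j M :> 'M[R]_k.
  apply/matrixP => a b; rewrite !mxE.
  have -> : lift ord0 a = rshift 1 a :> 'I_(1 + k) by apply: val_inj.
  by rewrite (unsplitK (inr a)).
congr (_ * _); rewrite mulrC; congr (_ * _).
have -> : r 0 j = col_mx r M (lshift k ord0) j by rewrite col_mxEu.
by congr (fun_of_matrix _ _ _); apply: val_inj.
Qed.

Lemma det_colsub_col_mx k v (A : 'M[R]_(k, n.+1)) (g : 'I_k.+1 -> 'I_n.+1) :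
  \det (colsub g (col_mx v A) : 'M[R]_(k.+1)) =
  \sum_(j < k.+1) (-1) ^+ j * v 0 (g j) * \det (colsub (g \o lift j) A).
Proof.
have -> : (colsub g (col_mx v A) : 'M[R]_(k.+1)) = col_mx (colsub g v) (colsub g A).
  by apply/matrixP => i j; rewrite !mxE; case: fintype.split => a; rewrite !mxE.
rewrite det_col_mx; apply: eq_bigr => j _; rewrite mxE; congr (_ * \det _).
by apply/matrixP => a b; rewrite !mxE.
Qed.

Definition TNN k (A : 'M[R]_(k, n.+1)) :=
  forall f : 'I_k -> 'I_n.+1, increasing f -> 0 <= \det (colsub f A).
Definition TP k (A : 'M[R]_(k, n.+1)) :=
  forall f : 'I_k -> 'I_n.+1, increasing f -> 0 < \det (colsub f A).

(** The cofactor signs along the row [v] cancel the alternation of [v]: up to the global sign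
    [(-1)^e], all terms of the expansion are nonnegative, and each one is at most their sum. *)
Lemma alternate_det_ge0 k (A : 'M[R]_(k, n.+1)) v e (g : 'I_k.+1 -> 'I_n.+1) :
  TP A -> increasing g -> (forall j : 'I_k.+1, 0 <= (-1) ^+ (e + j) * v 0 (g j)) ->
  0 <= (-1) ^+ e * \det (colsub g (col_mx v A) : 'M[R]_(k.+1)) /\
  forall j, `|v 0 (g j)| * \det (colsub (g \o lift j) A) <=
            (-1) ^+ e * \det (colsub g (col_mx v A) : 'M[R]_(k.+1)).
Proof.
move=> tpA hg alt.
have E : (-1) ^+ e * \det (colsub g (col_mx v A) : 'M[R]_(k.+1)) =
    \sum_j `|v 0 (g j)| * \det (colsub (g \o lift j) A).
  rewrite det_colsub_col_mx mulr_sumr; apply: eq_bigr => j _.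
  rewrite !mulrA -exprD; congr (_ * _).
  rewrite -(ger0_norm (alt j)) normrM normrX normrN1 expr1n mul1r.
  by [].
have ge0 j : 0 <= `|v 0 (g j)| * \det (colsub (g \o lift j) A).
  by rewrite mulr_ge0// ltW// tpA//; apply: increasing_lift.
rewrite E; split=> [|j]; first exact: sumr_ge0.
by rewrite (bigD1 j)//= lerDl sumr_ge0.
Qed.

Lemma colsub_mul k m p (B : 'M[R]_(m, k)) (A : 'M[R]_(k, n.+1)) (f : 'I_p -> 'I_n.+1) :
  colsub f (B *m A) = B *m colsub f A.
Proof. by apply/matrixP => i j; rewrite !mxE; apply: eq_bigr => l _; rewrite !mxE. Qed.

Lemma TP_inj k (A : 'M[R]_(k, n.+1)) (f : 'I_k -> 'I_n.+1) (y : 'rV[R]_k) :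
  TP A -> increasing f -> (forall j, (y *m A) 0 (f j) = 0) -> y = 0.
Proof.
move=> tpA hf yf; have uA : colsub f A \in unitmx.
  by rewrite unitmxE unitfE gt_eqF// tpA.
have : y *m colsub f A = 0.
  by rewrite -colsub_mul; apply/rowP => j; rewrite !mxE -[RHS](yf j) mxE.
by move=> /(congr1 (mulmx^~ (invmx (colsub f A)))); rewrite mulmxK// mul0mx.
Qed.

Lemma TP_interp k (A : 'M[R]_(k, n.+1)) (f : 'I_k -> 'I_n.+1) (r : 'I_k -> R) :
  TP A -> increasing f -> exists y : 'rV[R]_k, forall j, (y *m A) 0 (f j) = r j.
Proof.
move=> tpA hf; have uA : colsub f A \in unitmx.
  by rewrite unitmxE unitfE gt_eqF// tpA.
exists ((\row_j r j) *m invmx (colsub f A)) => j.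
have : (\row_j r j *m invmx (colsub f A)) *m colsub f A = \row_j r j by rewrite mulmxKV.
by rewrite -colsub_mul => /rowP/(_ j); rewrite !mxE.
Qed.

Lemma det_colsub_col_mx_mul k (y : 'rV[R]_k) (A : 'M[R]_(k, n.+1))
    (g : 'I_k.+1 -> 'I_n.+1) :
  \det (colsub g (col_mx (y *m A) A) : 'M[R]_(k.+1)) = 0.
Proof.
apply/eqP/det0P; exists (row_mx (-1)%:M y).
  apply/eqP => /(congr1 (@lsubmx R 1 1 k)); rewrite row_mxKl => /rowP/(_ ord0).
  by rewrite !mxE eqxx => /eqP; rewrite oppr_eq0 oner_eq0.
rewrite -colsub_mul (mul_row_col (-1)%:M y) mul_scalar_mx scaleN1r addNr.
by apply/matrixP => i j; rewrite !mxE.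
Qed.

(* Gantmakher-Krein: a weakly alternating vector of length k + 1 would make
   all terms in the expansion of a vanishing determinant vanish. *)
Lemma TP_wtot_le k (A : 'M[R]_(k, n.+1)) (y : 'rV[R]_k) e :
  TP A -> y != 0 -> (wtot e (sign (y *m A)) <= k)%N.
Proof.
move=> tpA; apply: contraNleq => /wtot_alternate[g hg /(_ _ erefl) alt]; apply/eqP.
have [_ H] := alternate_det_ge0 tpA hg alt.
have d0 := det_colsub_col_mx_mul y A g.
(* The vector vanishes on all of [g]; the [k] positions other than [g 0] already force [y = 0]. *)
apply: (TP_inj tpA (increasing_lift ord0 hg)) => j /=.
have := H (lift ord0 j); rewrite d0 mulr0 pmulr_lle0 ?normr_le0; last first.
  by apply: tpA; apply: increasing_lift.
by move=> /eqP.
Qed.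

End Minors.

(** * Realizing sign vectors in a totally positive row space *)

Section Realization.
Variables (R : realType) (n : nat).
Implicit Types (v u : 'rV[R]_n.+1) (s : signvec n.+1).

Definition sgr (x : sgn) : R :=
  match x with Zero => 0 | Pos => 1 | Neg => -1 end.

Lemma sgn_of_sgr (c : R) x : 0 < c -> sgn_of (c * sgr x) = x.
Proof.
move=> c0; rewrite /sgn_of; case: x => /=; rewrite ?mulr0 ?mulr1 ?mulrN1 ?eqxx//.
  by rewrite gt_eqF// c0.
by rewrite oppr_eq0 gt_eqF// oppr_gt0 ltNge ltW.
Qed.

Lemma sgn_ofN (x : R) : sgn_of (- x) = sgn_opp (sgn_of x).
Proof. by rewrite /sgn_of oppr_eq0 oppr_gt0; case: (ltgtP x 0). Qed.

Lemma sgn_ofM (c x : R) : 0 < c -> sgn_of (c * x) = sgn_of x.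
Proof.
by move=> c0; rewrite /sgn_of mulf_eq0 gt_eqF//= pmulr_rgt0.
Qed.

Lemma sgn_of_eq0 (x : R) : (sgn_of x == Zero) = (x == 0).
Proof. by rewrite /sgn_of; case: (ltgtP x 0). Qed.

Lemma sgn_of_small (a b : R) : `|b| < `|a| -> sgn_of (a + b) = sgn_of a.
Proof.
rewrite /sgn_of; case: (ltgtP a 0) => a0 ba; last by move: ba; rewrite a0 normr0 normr_lt0.
  move: ba; rewrite (ltr0_norm a0) ltr_norml => /andP[_ ba].
  have : a + b < 0 by lra.
  by case: ltgtP.
move: ba; rewrite (gtr0_norm a0) ltr_norml => /andP[ba _].
have : 0 < a + b by lra.
by case: ltgtP.
Qed.

Lemma small_scale m (x v : 'I_m -> R) :
  exists2 d : R, 0 < d & forall i, v i != 0 -> `|d * x i| < `|v i|.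
Proof.
(* The 1 keeps [S] positive and the bound strict; an index with [v i = 0] contributes 0 because the
   inverse of 0 is 0. *)
pose S := 1 + \sum_i `|x i| / `|v i|.
have S0 i : `|x i| / `|v i| < S.
  by rewrite /S (bigD1 i)//= addrCA ltrDl ltr_pwDl// sumr_ge0.
have Sp : 0 < S by rewrite ltr_pwDl// sumr_ge0.
exists S^-1; first by rewrite invr_gt0.
move=> i vi; have := S0 i; rewrite ltr_pdivrMr ?normr_gt0// normrM gtr0_norm ?invr_gt0//.
by rewrite ltr_pdivrMl.
Qed.

Lemma cnt_inj (P : pred nat) i j : P i -> P j -> cnt P i = cnt P j -> i = j.
Proof.
move=> Pi Pj ij; case: (ltngtP i j) => // /(cnt_mono P); rewrite cntS ?Pi ?Pj; lia.
Qed.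

(** As [i] runs from 0 to [m], the quantity [wcount d s i + (m - i)] is constant at selected
    positions and drops by one at the others. It goes from [m >= k] to a value below [k], so it
    leaves the value [k] at an unselected position. *)
Lemma wcount_threshold (d : bool) (s : nat -> sgn) m k :
  (k <= m)%N -> (wcount d s m < k)%N ->
  exists i, [/\ (i < m)%N, (wcount d s i + (m - i) = k)%N & ~~ wsel d s i].
Proof.
move=> km mk; pose P T := (T <= m)%N && (k <= wcount d s T + (m - T))%N.
have P0 : exists T, P T by exists 0%N; rewrite /P /= subn0.
have PM T : P T -> (T <= m)%N by case/andP.
case: (ex_maxnP P0 PM) => i /andP[im ki] imax.
have {}im : (i < m)%N.
  rewrite ltn_neqAle im andbT; apply/eqP => iE; move: ki; rewrite iE subnn; lia.
have := imax i.+1; rewrite /P im /= ltnn => H.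
have : ~~ (k <= wcount d s i + allowed d (wcount d s i) (s i) + (m - i.+1))%N.
  by apply/negP => /H.
rewrite /wsel; case Ea : (allowed _ _ _) => ki'; exists i; split; rewrite ?Ea//; lia.
Qed.

Lemma cnt_cofinite (P : pred nat) i m :
  (forall j, (i <= j)%N -> P j) -> cnt P (i + m) = (cnt P i + m)%N.
Proof.
move=> Pi; elim: m => [|m IH]; first by rewrite !addn0.
by rewrite addnS cntS IH Pi ?leq_addr// addn1 addnS.
Qed.

(* A vector of the row space vanishing on a set J of k - 1 positions has, by
   the upper bound on its variation, no freedom in its signs off J: they
   alternate at each element of J. Take J to contain the positions where s
   alternates, and correct the signs on J by a small interpolating vector. *)
Lemma TP_sign_realize k (A : 'M[R]_(k, n.+1)) s :
  TP A -> (k <= n.+1)%N -> s <> signvec0 n.+1 -> (forall e, wtot e s <= k)%N ->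
  exists y : 'rV[R]_k, sign (y *m A) = s.
Proof.
move=> tpA kn s0 sk; have [e se] := wtot_diff s0.
set d := ~~ e in se; have dk : (wcount d (letter s) n.+1 < k)%N.
  by have := sk e; rewrite se.
have [i0 [i0n i0k i0sel]] := wcount_threshold kn dk.
pose sel := wsel d (letter s).
(* [P] is [J] together with the pivot [i0]. It has exactly [k] elements, so values on [P] can be
   prescribed: [v] will vanish on [J] and have the sign of [s] at [i0]. *)
pose P i := (i0 <= i)%N || sel i; pose J i := (i0 < i)%N || sel i.
have cP i : (i <= i0)%N -> cnt P i = wcount d (letter s) i.
  move=> ii0; rewrite wcountE; apply: eq_cnt => j ji.
  by rewrite /P leqNgt (leq_trans ji ii0).
have cJ i : (i <= i0)%N -> cnt J i = wcount d (letter s) i.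
  move=> ii0; rewrite wcountE; apply: eq_cnt => j ji.
  by rewrite /J ltnNge ltnW// (leq_trans ji ii0).
have cPn : cnt P n.+1 = k.
  rewrite -[X in cnt P X](subnKC (ltnW i0n)) cnt_cofinite ?cP//.
  by move=> j; rewrite /P => ->.
have cJn : (cnt J n.+1).+1 = k.
  rewrite -[X in cnt J X](subnKC i0n) cnt_cofinite; last by move=> j; rewrite /J => ->.
  rewrite cntS cJ// {1}/J ltnn orFb /sel (negbTE i0sel); lia.
have [h [h1 h2 h3]] := cnt_enum cPn.
have hsurj i : (i < n.+1)%N -> P i -> exists j, h j = i :> nat.
  move=> im Pi; have ik : (cnt P i < k)%N.
    by rewrite -[X in (_ < X)%N]cPn; have := cnt_mono P im; rewrite cntS Pi; lia.
  by exists (Ordinal ik); apply: (@cnt_inj P) => //; rewrite h3.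
have Pi0 : P i0 by rewrite /P leqnn.
have [yv yvE] := TP_interp (fun j => if h j == i0 :> nat then sgr (letter s i0) else 0) tpA h1.
pose v := yv *m A.
have vi0 : letter (sign v) i0 = letter s i0.
  have [j hj] := hsurj _ i0n Pi0; rewrite -{1}hj letter_signE /v yvE hj eqxx.
  by rewrite -[sgr _]mul1r sgn_of_sgr.
have JP i : J i -> P i /\ i != i0.
  rewrite /J /P => /orP[ii|si]; first by rewrite ltnW//; split=> //; lia.
  by rewrite si orbT; split=> //; apply: contraTneq si => ->.
have vJ i : (i < n.+1)%N -> J i -> v 0 (inord i) = 0.
  move=> im /JP[/(hsurj _ im)[j hj] ii0].
  by have := yvE j; rewrite hj (negbTE ii0) => <-; rewrite -hj inord_val.
have sv0 : sign v <> signvec0 n.+1.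
  move=> /ffunP/(_ (inord i0)); rewrite -/(letter _ i0) vi0 ffunE => si0.
  by move: i0sel; rewrite /wsel /allowed si0.
have yv0 : yv != 0.
  apply: contra_notN sv0 => /eqP yv0; apply/ffunP => i.
  by rewrite /v yv0 mul0mx !ffunE mxE /sgn_of eqxx.
have [e' se'] := wtot_diff sv0; set d' := ~~ e' in se'.
(* Zeros are always selected, so [J] is contained in the selection of [v]. The search [d'] is one
   shorter than [e'], hence has length at most [k - 1], the size of [J]. *)
have JE : forall i, (i < n.+1)%N -> J i = wsel d' (letter (sign v)) i.
  apply: cnt_sub_eq => [i im Ji|].
    by rewrite /wsel /allowed letter_sign vJ// /sgn_of eqxx.
  rewrite -wcountE; have := TP_wtot_le e' tpA yv0; rewrite -/v se' /wtot; lia.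
have wE i : (i <= i0)%N -> wcount d' (letter (sign v)) i = wcount d (letter s) i.
  move=> ii0; rewrite wcountE -cJ//; apply: eq_cnt => j ji.
  by rewrite JE//; apply: (leq_trans ji); apply: (leq_trans ii0); apply: ltnW.
have nJ i : ~~ J i -> [/\ (i <= i0)%N & ~~ sel i].
  by rewrite /J negb_or -leqNgt => /andP[].
have sE i : ~~ J i -> letter s i = req (~~ d) (wcount d (letter s) i).
  by move=> /nJ[_ /not_allowed].
have vE i : ~~ J i -> letter (sign v) i = req (~~ d') (wcount d (letter s) i).
  move=> Ji; have [ii0 _] := nJ _ Ji; rewrite -wE//; apply: not_allowed.
  by rewrite -/(wsel _ _ _) -JE//; apply: leq_ltn_trans ii0 i0n.
have nJi0 : ~~ J i0 by rewrite /J ltnn.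
(* The common sign of [v] and [s] at the unselected position [i0] identifies the two starting
   signs. *)
have dd' : d' = d.
  by apply: negb_inj; apply: (@req_inj _ _ (wcount d (letter s) i0)); rewrite -vE// -sE.
(* The correction [y] carries the signs of [s] on [P], in particular on [J] where [v] vanishes; the
   factor [c] is small enough to preserve the nonzero entries of [v]. *)
have [y yE] := TP_interp (fun j => sgr (s (h j))) tpA h1.
have [c c0 cE] := small_scale (fun i => (y *m A) 0 i) (fun i => v 0 i).
exists (yv + c *: y); apply/ffunP => i; rewrite ffunE mulmxDl -/v -scalemxAl.
rewrite [X in sgn_of X]mxE [X in _ + X]mxE.
have [Ji|Ji] := boolP (J i).
  have -> : v 0 i = 0 by rewrite -(vJ i)// inord_val.
  have [j hj] := hsurj i (ltn_ord i) (JP _ Ji).1.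
  have {}hj : h j = i by apply: val_inj.
  by rewrite add0r -hj yE sgn_of_sgr.
have svi : sgn_of (v 0 i) = s i.
  by rewrite -letter_signE vE// dd' -sE// letterE.
rewrite sgn_of_small// cE//; rewrite -sgn_of_eq0 svi -letterE sE//.
exact: req_neq0.
Qed.

(** Otherwise some vector of the row space has the same signs as [u]. Its scalar product with [u] is
    a sum of nonnegative terms equal to 0, which forces [u = 0]. *)
Lemma TP_orth k (A : 'M[R]_(k, n.+1)) u :
  TP A -> (k <= n.+1)%N -> u != 0 -> A *m u^T = 0 ->
  exists e, (k < wtot e (sign u))%N.
Proof.
move=> tpA kn u0 Au; apply: contrapT => H.
have [] := @TP_sign_realize k A (sign u) tpA kn (sign_neq0 u0).
  by move=> e; rewrite leqNgt; apply/negP => He; apply: H; exists e.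
move=> y /ffunP sy.
have ge0 i : 0 <= (y *m A) 0 i * u 0 i.
  have := sy i; rewrite !ffunE /sgn_of.
  case: (ltgtP (u 0 i) 0) => ui; case: (ltgtP ((y *m A) 0 i) 0) => // yi _.
  - by rewrite mulr_le0// ltW.
  - by rewrite mulr_ge0// ltW.
  - by rewrite ui mulr0.
have : (y *m A *m u^T) 0 0 = 0 by rewrite -mulmxA Au mulmx0 mxE.
rewrite mxE; under eq_bigr do rewrite [u^T _ _]mxE.
move=> /eqP; rewrite psumr_eq0; last by move=> i _; apply: ge0.
move=> /allP yu; move/eqP: u0; apply; apply/rowP => i; rewrite mxE.
have := yu i (mem_index_enum _); rewrite mulf_eq0 => /orP[|/eqP//].
by rewrite -sgn_of_eq0; have := sy i; rewrite !ffunE => ->; rewrite sgn_of_eq0 => /eqP.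
Qed.

End Realization.

(** * From totally positive to totally nonnegative matrices *)

Section Perturbation.
Variables (R : realType) (n k : nat).
Implicit Types (f g : {ffun 'I_k -> 'I_n.+1}) (u : 'rV[R]_n.+1).

Definition incr f := [forall i : 'I_k, forall j : 'I_k, (i < j)%N ==> (f i < f j)%N].

Lemma incrP f : reflect (increasing f) (incr f).
Proof.
apply: (iffP forallP) => [H i j ij|H i].
  by have /forallP/(_ j)/implyP/(_ ij) := H i.
by apply/forallP => j; apply/implyP => /H.
Qed.

Definition upd f (j : 'I_k) (b : 'I_n.+1) : {ffun 'I_k -> 'I_n.+1} :=
  [ffun c => if c == j then b else f c].

Definition adjacent (a b : nat) := (b == a.+1) || (a == b.+1).

(** Walk from [f] to [g] by unit moves: raise the last index that is below its target or, if there
    is none, lower the first one above its target. Both moves keep the sequence increasing and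
    reduce the distance to [g]; [Z] must switch on at some move. *)
Lemma increasing_connect (Z : pred {ffun 'I_k -> 'I_n.+1}) f g :
  increasing f -> increasing g -> ~~ Z f -> Z g ->
  exists f1 j b, [/\ increasing f1, ~~ Z f1, increasing (upd f1 j b),
    Z (upd f1 j b) & adjacent (f1 j) b].
Proof.
pose dist f := (\sum_j ((f j - g j) + (g j - f j)))%N.
have [m] := ubnP (dist f); elim: m => // m IH in f * => fm hf hg Zf Zg.
have step j (b : 'I_n.+1) : increasing (upd f j b) -> adjacent (f j) b ->
    ((b - g j) + (g j - b) < (f j - g j) + (g j - f j))%N ->
    exists f1 j b, [/\ increasing f1, ~~ Z f1, increasing (upd f1 j b),
      Z (upd f1 j b) & adjacent (f1 j) b].
  move=> hu adj lt; have [Zu|Zu] := boolP (Z (upd f j b)).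
    by exists f, j, b.
  apply: (IH _ _ hu hg Zu Zg); rewrite ltnS in fm; apply: leq_trans fm; rewrite /dist.
  rewrite (bigD1 j)//= [X in (_ < X)%N](bigD1 j)//= ffunE eqxx.
  rewrite (eq_bigr (fun i => (f i - g i) + (g i - f i))%N) ?ltn_add2r//.
  by move=> i ij; rewrite ffunE (negbTE ij).
have [/existsP[j0 fj0]|/existsPn ge] := boolP [exists j, (f j < g j)%N].
  case: (@arg_maxnP _ j0 (fun j => (f j < g j)%N) val fj0) => j fj jmax.
  have bn : ((f j).+1 < n.+1)%N by apply: leq_ltn_trans (ltn_ord (g j)).
  apply: (step j (Ordinal bn)) => [a c ac||] /=; last 2 first.
  - by rewrite /adjacent eqxx.
  - lia.
  rewrite !ffunE; case: eqP => [aj|aj]; case: eqP => [cj|cj]; subst => //=.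
  - by rewrite ltnn in ac.
  - have := hg _ _ ac; have : (g c <= f c)%N; last lia.
    by rewrite leqNgt; apply/negP => /jmax /=; move: ac; lia.
  - by have := hf _ _ ac; lia.
  - exact: hf.
have [/existsP[j0 fj0]|/existsPn le] := boolP [exists j, (g j < f j)%N].
  case: (@arg_minnP _ j0 (fun j => (g j < f j)%N) val fj0) => j fj jmin.
  have bn : ((f j).-1 < n.+1)%N by have := ltn_ord (f j); lia.
  apply: (step j (Ordinal bn)) => [a c ac||] /=; last 2 first.
  - by rewrite /adjacent; lia.
  - lia.
  rewrite !ffunE; case: eqP => [aj|aj]; case: eqP => [cj|cj]; subst => //=.
  - by rewrite ltnn in ac.
  - by have := hf _ _ ac; lia.
  - have := hg _ _ ac; have : (f a <= g a)%N; last lia.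
    by rewrite leqNgt; apply/negP => /jmin /=; move: ac; lia.
  - exact: hf.
have fg : f = g.
  apply/ffunP => j; apply: val_inj => /=; have := ge j; have := le j; lia.
by rewrite -fg (negbTE Zf) in Zg.
Qed.

(** Multiplication on the right adds [t] times column [a] to column [b]. *)
Definition shear (a b : 'I_n.+1) (t : R) : 'M[R]_n.+1 := 1%:M + t *: delta_mx a b.

Lemma shearK a b t : a != b -> shear a b t *m shear a b (- t) = 1%:M.
Proof.
move=> ab; rewrite /shear mulmxDl !mulmxDr !mul1mx !mulmx1 -scalemxAl -scalemxAr.
by rewrite mul_delta_mx_0 ?scaler0 1?eq_sym// addr0 scaleNr -addrA addNr addr0.
Qed.

Lemma mul_shear (A : 'M[R]_(k, n.+1)) (a b : 'I_n.+1) t i c :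
  (A *m shear a b t) i c = A i c + (c == b)%:R * (t * A i a).
Proof.
rewrite mulmxDr mulmx1 -scalemxAr mxE; congr (_ + _); rewrite mxE.
rewrite mxE (bigD1 a)//= big1 ?addr0; last first.
  by move=> j ja; rewrite mxE (negbTE ja) mulr0.
by rewrite mxE eqxx /=; case: (c == b); rewrite ?mulr1 ?mulr0 ?mul0r ?mul1r ?mulr0.
Qed.

Lemma det_shear_out (A : 'M[R]_(k, n.+1)) (a b : 'I_n.+1) t f :
  (forall j, f j != b) -> \det (colsub f (A *m shear a b t)) = \det (colsub f A).
Proof.
move=> fb; congr (\det _); apply/matrixP => i j.
by rewrite [LHS]mxE mul_shear (negbTE (fb j)) mul0r addr0 mxE.
Qed.

Lemma det_shear_in (A : 'M[R]_(k, n.+1)) (a b : 'I_n.+1) t f j :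
  increasing f -> f j = b ->
  \det (colsub f (A *m shear a b t)) =
  \det (colsub f A) + t * \det (colsub (upd f j a) A).
Proof.
move=> hf fj; rewrite -[LHS]det_tr -[X in X + _]det_tr -[\det (colsub (upd _ _ _) _)]det_tr.
rewrite -[X in X + _]mul1r.
apply: (@determinant_multilinear _ _ _ _ _ j).
- apply/rowP => i; rewrite [LHS]mxE [LHS]mxE [LHS]mxE mul_shear fj eqxx mul1r.
  by rewrite !mxE fj mul1r ffunE eqxx.
- apply/matrixP => i c; rewrite ![LHS]mxE [RHS]mxE [RHS]mxE [RHS]mxE mul_shear.
  rewrite (_ : _ == b = false) ?mul0r ?addr0//; apply/eqP => E.
  by have /eqP := increasing_inj hf (etrans E (esym fj)); rewrite eq_sym (negbTE (neq_lift _ _)).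
- apply/matrixP => i c; rewrite ![LHS]mxE [RHS]mxE [RHS]mxE [RHS]mxE mul_shear.
  rewrite (_ : _ == b = false) ?mul0r ?addr0; last first.
    apply/eqP => E; have /eqP := increasing_inj hf (etrans E (esym fj)).
    by rewrite eq_sym (negbTE (neq_lift _ _)).
  by rewrite ffunE eq_sym (negbTE (neq_lift _ _)).
Qed.

(** Either [a] is already used by [f], and two columns coincide, or moving [b] to the adjacent [a]
    passes no other index, and the sequence stays increasing. *)
Lemma det_upd_ge0 (A : 'M[R]_(k, n.+1)) (a b : 'I_n.+1) f j : TNN A ->
  increasing f -> f j = b -> adjacent a b -> 0 <= \det (colsub (upd f j a) A).
Proof.
move=> nnA hf fj ab; have [/existsP[c /andP[cj /eqP fc]]|/existsPn H] :=
  boolP [exists c, (c != j) && (f c == a)].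
  rewrite -det_tr (determinant_alternate cj)// => i.
  by rewrite !mxE !ffunE eqxx (negbTE cj) fc.
apply: nnA => c d cd; rewrite !ffunE.
have H' c' : c' != j -> f c' <> a :> nat.
  move=> c'j /ord_inj E; by have := H c'; rewrite c'j E eqxx.
move: ab; rewrite /adjacent -fj => ab.
case: eqP => [cj|/eqP cj]; case: eqP => [dj|/eqP dj]; subst => //=.
- by rewrite ltnn in cd.
- by have := hf _ _ cd; have := H' _ dj; lia.
- by have := hf _ _ cd; have := H' _ cj; lia.
- exact: hf.
Qed.

Lemma det_shear_ge (A : 'M[R]_(k, n.+1)) (a b : 'I_n.+1) t f : TNN A -> 0 <= t ->
  increasing f -> adjacent a b ->
  \det (colsub f A) <= \det (colsub f (A *m shear a b t)).
Proof.
move=> nnA t0 hf ab; have [/existsP[j /eqP fj]|/existsPn fb] :=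
  boolP [exists j, f j == b]; last by rewrite det_shear_out.
by rewrite (det_shear_in _ _ _ hf fj) lerDl mulr_ge0// (det_upd_ge0 _ hf fj ab).
Qed.

(* Adding a small multiple of a column to an adjacent one keeps all maximal
   minors nonnegative, and turns a suitable zero minor into a positive one. *)
Lemma TNN_orth_aux (A : 'M[R]_(k, n.+1)) u f :
  TNN A -> (k <= n.+1)%N -> increasing f -> 0 < \det (colsub f A) ->
  u != 0 -> A *m u^T = 0 -> exists e, (k < wtot e (sign u))%N.
Proof.
pose zeros (A : 'M[R]_(k, n.+1)) := [set f | incr f && (\det (colsub f A) == 0)]%SET.
have [m] := ubnP #|zeros A|; elim: m => // m IH in A u * => Am nnA kn hf fA u0 Au.
have [/existsP[g /andP[/incrP hg gA]]|/existsPn tpA] :=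
  boolP [exists g, incr g && (\det (colsub g A) == 0)]; last first.
  apply: (TP_orth _ kn u0 Au) => g hg; rewrite lt_neqAle nnA// andbT.
  have := tpA (finfun g); have -> : incr (finfun g).
    by apply/incrP => i j ij; rewrite !ffunE; apply: hg.
  have -> : colsub (finfun g) A = colsub g A by apply/matrixP => i j; rewrite !mxE ffunE.
  by rewrite /= eq_sym.
have Zf : ~~ (\det (colsub f A) == 0) by rewrite gt_eqF.
have [f1 [j [b [hf1 Zf1 hup Zup adj]]]] :=
  increasing_connect (Z := fun f => \det (colsub f A) == 0) hf hg Zf gA.
set a := f1 j in adj.
have ab : a != b by apply: contraTneq adj => ->; rewrite /adjacent; lia.
have [t t0 tE] := small_scale (fun i : 'I_n.+1 => (i == a)%:R * u 0 b) (fun i => u 0 i).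
(* The inverse shear on [u] preserves orthogonality. It changes only the entry at [a], by an amount
   too small to affect a nonzero sign. *)
pose A' := A *m shear a b t; pose u' := (shear a b (- t) *m u^T)^T.
have Au' : A' *m u'^T = 0 by rewrite trmxK /A' -mulmxA (mulmxA (shear _ _ _)) shearK// mul1mx.
have u'E i : u' 0 i = u 0 i - t * ((i == a)%:R * u 0 b).
  rewrite mxE /shear mulmxDl mul1mx -scalemxAl 2!mxE; congr (_ + _).
  rewrite mxE mxE (bigD1 b)//= big1 ?addr0; last first.
    by move=> c cb; rewrite mxE (negbTE cb) andbF mul0r.
  by rewrite !mxE eqxx andbT mulNr.
have ref i : u 0 i != 0 -> sgn_of (u' 0 i) = sgn_of (u 0 i).
  by move=> ui; rewrite u'E sgn_of_small// normrN tE.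
have u'0 : u' != 0.
  apply: contraNneq u0 => u'0; apply/eqP/rowP => i; rewrite mxE; apply/eqP.
  apply: contraT => ui; have := ref i ui; rewrite u'0 mxE {1}/sgn_of eqxx => /esym/eqP.
  by rewrite sgn_of_eq0 (negbTE ui).
have nnA' : TNN A'.
  move=> h hh.
  have -> : colsub h A' = colsub (finfun h) A' by apply/matrixP => i c; rewrite !mxE ffunE.
  have hh' : increasing (finfun h) by move=> i c ic; rewrite !ffunE; apply: hh.
  by apply: le_trans (det_shear_ge nnA (ltW t0) hh' adj); apply: nnA.
have [||e ek] := IH A' u' _ nnA' kn hf _ u'0 Au'.
- rewrite ltnS in Am; apply: leq_trans Am; apply: proper_card; apply/properP; split.
    apply/fintype.subsetP => h; rewrite !inE => /andP[/incrP hh h0].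
    rewrite (introT (incrP _) hh) /= eq_le nnA// andbT -(eqP h0).
    by apply: det_shear_ge nnA (ltW t0) hh adj.
  exists (upd f1 j b); rewrite !inE (introT (incrP _) hup) //= .
  have uj : upd f1 j b j = b by rewrite ffunE eqxx.
  (* The minor at [upd f1 j b] was 0 and becomes [t] times the nonzero minor at [f1], so it leaves
     the set of zeros. *)
  rewrite (det_shear_in _ _ _ hup uj) (eqP Zup) add0r mulf_eq0 gt_eqF//=.
  have -> : upd (upd f1 j b) j a = f1.
    by apply/ffunP => c; rewrite !ffunE; case: eqP => [->|].
  by [].
- exact: lt_le_trans fA (det_shear_ge nnA (ltW t0) hf adj).
(* A zero of [u] may become nonzero in [u']; this can only shorten the alternations, so the lower
   bound passes from [u'] to [u]. *)
exists e; apply: leq_trans ek _; apply: wcount_refine => i im.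
by rewrite !letter_sign sgn_of_eq0; apply: ref.
Qed.

(** [fullrankfun] gives independent columns in an unspecified order; enumerating the same columns
    increasingly keeps their span. *)
Lemma row_free_minor (A : 'M[R]_(k, n.+1)) : row_free A ->
  exists2 f : {ffun 'I_k -> 'I_n.+1}, increasing f & \det (colsub f A) != 0.
Proof.
move=> Af; have Aft : row_full A^T by rewrite /row_full mxrank_tr.
pose h := fullrankfun Aft; pose P (i : nat) := [exists j, h j == i :> nat].
have cP : cnt P n.+1 = k.
  rewrite /cnt -val_enum_ord count_map -size_filter -[RHS]card_ord.
  rewrite -(card_codom (@fullrankfun_inj _ _ _ _ Aft)) cardE; congr size.
  rewrite enumT; apply: eq_filter => i /=; apply/existsP/codomP => -[j].
    by move=> /eqP /ord_inj <-; exists j.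
  by move=> ->; exists j.
have [g [g1 g2 g3]] := cnt_enum cP; exists (finfun g).
  by move=> i j ij; rewrite !ffunE; apply: g1.
rewrite -unitfE -unitmxE -unitmx_tr -row_full_unit.
have := fullrowsub_full Aft; rewrite -!sub1mx => /submx_trans; apply.
apply/row_subP => i; have Ph : P (h i) by apply/existsP; exists i.
have ik : (cnt P (h i) < k)%N.
  by rewrite -[X in (_ < X)%N]cP; have := cnt_mono P (ltn_ord (h i)); rewrite cntS Ph; lia.
have [j E] : exists j, g j = h i.
  by exists (Ordinal ik); apply: val_inj; apply: (@cnt_inj P); [exact: g2|exact: Ph|exact: (g3 (Ordinal ik))].
suff -> : row i (rowsub h A^T) = row j (colsub (finfun g) A)^T by apply: row_sub.
by apply/rowP => c; rewrite !mxE [in RHS]ffunE E.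
Qed.

Lemma TNN_orth (A : 'M[R]_(k, n.+1)) u : row_free A -> TNN A ->
  u != 0 -> A *m u^T = 0 -> exists e, (k < wtot e (sign u))%N.
Proof.
move=> Af nnA u0 Au; have [f hf fA] := row_free_minor Af.
apply: (TNN_orth_aux nnA _ hf _ u0 Au); first by rewrite -(eqP Af) rank_leq_col.
by rewrite lt_neqAle eq_sym fA nnA.
Qed.

End Perturbation.

(** * Totally nonnegative spaces orthogonal to a given vector *)

Section OrthogonalTNN.
Variables (R : realType) (n : nat).
Implicit Types (v u : 'rV[R]_n.+1).

Lemma increasing_id k (h : 'I_k -> 'I_k) : {homo h : i j / (i < j)%N} -> h =1 id.
Proof.
move=> hh.
have ge m (c : 'I_k) : c = m :> nat -> (m <= h c)%N.
  elim: m c => // m IH c cm; have mk : (m < k)%N by have := ltn_ord c; lia.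
  have := IH (Ordinal mk) erefl; have : (h (Ordinal mk) < h c)%N by apply: hh; rewrite /= cm.
  lia.
have le m (c : 'I_k) : (c + m.+1)%N = k -> (h c <= c)%N.
  elim: m c => [|m IH] c cm; first by have := ltn_ord (h c); lia.
  have mk : (c.+1 < k)%N by lia.
  have ck : (Ordinal mk + m.+1)%N = k by rewrite /=; lia.
  by have := IH _ ck; have : (h c < h (Ordinal mk))%N by [apply: hh]; rewrite /=; lia.
move=> c; apply: val_inj; apply/eqP; rewrite eqn_leq ge// andbT.
by apply: (le (k - c.+1)%N); have := ltn_ord c; lia.
Qed.

Lemma increasing_miss k (h : 'I_k -> 'I_k.+1) : {homo h : i j / (i < j)%N} ->
  exists j : 'I_k.+1, forall c, h c = lift j c.
Proof.
move=> hh; have hi : injective h by apply: increasing_inj hh.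
have [/forallP H|/forallPn[j /existsPn jh]] := boolP [forall j, exists c, h c == j].
  have : (k.+1 <= k)%N.
    rewrite -{1}[k.+1]card_ord -[X in (_ <= X)%N]card_ord -(card_codom hi).
    apply: subset_leq_card; apply/fintype.subsetP => j _.
    by have /existsP[c /eqP <-] := H j; apply: codom_f.
  by rewrite ltnn.
have H c : exists c', h c = lift j c'.
  by case: (unliftP j (h c)) => [c' ->|E]; [exists c'|have := jh c; rewrite E eqxx].
have /choice[h' hE] := H.
exists j => c; rewrite hE increasing_id// => a b ab.
by have := hh _ _ ab; rewrite !hE /= /bump; do 2 case: leqP; lia.
Qed.

Lemma minor_row_free k (A : 'M[R]_(k, n.+1)) (f : 'I_k -> 'I_n.+1) :
  \det (colsub f A) != 0 -> row_free A.
Proof.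
rewrite -unitfE -unitmxE => u; apply/row_freeP.
exists (colsub f 1%:M *m invmx (colsub f A)).
by rewrite mulmxA -colsub_mul mulmx1 mulmxV.
Qed.

(* The maximal minors of k vectors spanning a hyperplane are, up to sign, the
   coordinates of its normal vector. *)
Lemma hyperplane_minors k (y : 'rV[R]_k.+1) j0 : y 0 j0 != 0 ->
  (forall j : 'I_k.+1, 0 <= (-1) ^+ j * y 0 j) ->
  exists M : 'M[R]_(k, k.+1), [/\ M *m y^T = 0,
    forall j, 0 <= \det (col' j M) & \det (col' j0 M) != 0].
Proof.
move=> y0 yge.
(* Row [i] is the unit vector at [lift j0 i], corrected at [j0] to be orthogonal to [y]; deleting
   column [j0] leaves the identity. *)
pose M : 'M[R]_(k, k.+1) := \matrix_(i, c)
  if unlift j0 c is Some i' then (i == i')%:R else - (y 0 (lift j0 i) / y 0 j0).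
have ME (q : 'I_k.+1 -> R) i : \sum_c M i c * q c =
    q (lift j0 i) - y 0 (lift j0 i) / y 0 j0 * q j0.
  rewrite (bigD1_ord j0)//= mxE unlift_none addrC mulNr; congr (_ - _).
  rewrite (bigD1 i)//= mxE liftK eqxx mul1r big1 ?addr0// => i' ii'.
  by rewrite mxE liftK eq_sym (negbTE ii') mul0r.
have dj0 : \det (col' j0 M) = 1.
  rewrite -[RHS](det1 R k); congr (\det _); apply/matrixP => a b.
  by rewrite !mxE liftK.
(* The vector of signed minors. Repeating a row of [M] gives a zero determinant whose expansion says
   [M q = 0], so [q] is proportional to [y]. *)
pose q (j : 'I_k.+1) := (-1) ^+ j * \det (col' j M).
have qE j : q j = y 0 j / y 0 j0 * q j0.
  case: (unliftP j0 j) => [i ->|->]; last by rewrite divff ?mul1r.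
  apply/eqP; rewrite -subr_eq0 -ME.
  have := det_col_mx (row i M) M; rewrite [LHS](_ : _ = 0); last first.
    apply/eqP/det0P; exists (row_mx (-1)%:M (delta_mx 0 i)).
      apply/eqP => /(congr1 (@lsubmx R 1 1 k)); rewrite row_mxKl => /rowP/(_ ord0).
      by rewrite !mxE eqxx => /eqP; rewrite oppr_eq0 oner_eq0.
    by rewrite (mul_row_col (-1)%:M) mul_scalar_mx scaleN1r -rowE addNr.
  move=> E; apply/eqP; rewrite [RHS]E; apply: eq_bigr => c _; rewrite [row _ _ _ _]mxE /q; ring.
have yj0 : 0 < (-1) ^+ j0 * y 0 j0.
  by rewrite lt_neqAle yge andbT eq_sym mulf_neq0// signr_eq0.
exists M; split=> [|j|]; last by rewrite dj0 oner_eq0.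
  apply/matrixP => i c; rewrite mxE [RHS]mxE; under eq_bigr do rewrite [y^T _ _]mxE.
  by rewrite (ME (fun c' => y c c')) (ord1 c) divfK// subrr.
have -> : \det (col' j M) = ((-1) ^+ j * y 0 j) / ((-1) ^+ j0 * y 0 j0).
  have -> : \det (col' j M) = (-1) ^+ j * q j.
    by rewrite /q signrMK.
  rewrite qE /q dj0 mulr1 invr_signM; ring.
by rewrite divr_ge0// ltW.
Qed.

(** Solve the problem on the [k + 1] columns of a weak alternation, where the hyperplane orthogonal
    to [v] works, and put zeros in all other columns. *)
Lemma exists_TNN_orth k v e : (k < wtot e (sign v))%N ->
  exists A : 'M[R]_(k, n.+1), [/\ row_free A, TNN A & A *m v^T = 0].
Proof.
move=> kw; have [g hg /(_ v erefl) alt] := wtot_alternate R kw.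
have [y [j0 [yj0 yge yv]]] : exists y : 'rV[R]_k.+1, exists j0, [/\ y 0 j0 != 0,
    forall j : 'I_k.+1, 0 <= (-1) ^+ j * y 0 j &
    forall M : 'M[R]_(k, k.+1), M *m y^T = 0 -> M *m (colsub g v)^T = 0].
  have [/existsP[j0 vj0]|/existsPn v0] := boolP [exists j, v 0 (g j) != 0].
    exists ((-1) ^+ e *: colsub g v), j0; split=> [|j|M].
    - by rewrite !mxE mulf_neq0// signr_eq0.
    - by rewrite !mxE mulrA -exprD addnC alt.
    - rewrite linearZ /= -scalemxAr => /eqP; rewrite scaler_eq0 signr_eq0 /=.
      by move/eqP.
  (* If [v] vanishes on all of [g], orthogonality is automatic and any nonzero alternating normal
     vector serves. *)
  exists (\row_(j < k.+1) (-1) ^+ j), ord0; split=> [|j|M _].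
  - by rewrite mxE expr0 oner_eq0.
  - by rewrite mxE -exprD addnn -muln2 exprM sqrr_sign.
  - have -> : colsub g v = 0.
      by apply/rowP => j; rewrite !mxE; apply/eqP; have := v0 j; rewrite negbK.
    by rewrite trmx0 mulmx0.
have [M [My Mge Mj0]] := hyperplane_minors yj0 yge.
pose G : 'M[R]_(k.+1, n.+1) := \matrix_(j, c) (g j == c)%:R.
have AE i c j : g j = c -> (M *m G) i c = M i j.
  move=> gj; rewrite mxE (bigD1 j)//= mxE gj eqxx mulr1 big1 ?addr0// => j' jj'.
  rewrite mxE -gj (inj_eq (increasing_inj hg)) (negbTE jj') mulr0//.
exists (M *m G); split.
- apply: (@minor_row_free _ _ (g \o lift j0)).
  rewrite (_ : colsub _ _ = col' j0 M)//.
  by apply/matrixP => a b; rewrite mxE (AE _ _ (lift j0 b))// mxE.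
- move=> f hf; have [/forallP fg|/forallPn[c /existsPn fc]] :=
    boolP [forall c, exists j, g j == f c].
    have /choice[h hE] : forall c, exists j, g j = f c.
      by move=> c; have /existsP[j /eqP E] := fg c; exists j.
    have hh : {homo h : i j / (i < j)%N}.
      move=> a b ab; have := hf _ _ ab; rewrite -!hE => lt.
      rewrite ltnNge leq_eqVlt; apply/negP => /orP[/eqP/ord_inj E|/hg].
        by rewrite E ltnn in lt.
      by lia.
    have [j hj] := increasing_miss hh.
    rewrite (_ : colsub _ _ = col' j M)//.
    by apply/matrixP => a b; rewrite mxE (AE _ _ (h b))// hj mxE.
  rewrite -det_tr (expand_det_row _ c) big1// => i _; rewrite [_^T _ _]mxE [colsub _ _ _ _]mxE.
  rewrite mxE big1 ?mul0r// => j _; rewrite mxE (negbTE (fc j)) mulr0//.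
- rewrite -mulmxA (_ : G *m v^T = (colsub g v)^T) ?yv//.
  apply/matrixP => j c; rewrite !mxE (bigD1 (g j))//= !mxE eqxx mul1r big1 ?addr0 ?(ord1 c)//.
  by move=> c' cj; rewrite !mxE eq_sym (negbTE cj) mul0r.
Qed.

End OrthogonalTNN.

(** * Vector spaces as row spaces of matrices *)

Section RowSpan.
Variables (R : realType) (n : nat).
Implicit Types (v u : 'rV[R]_n.+1).

Lemma span_familyP m (X : 'I_m -> 'rV[R]_n.+1) v :
  v \in <<[seq X i | i : 'I_m]>>%VS <-> exists y : 'rV[R]_m, v = y *m \matrix_i X i.
Proof.
have E y : y *m (\matrix_i X i) = \sum_i y 0 i *: X i.
  by rewrite mulmx_sum_row; apply: eq_bigr => i _; rewrite rowK.
split=> [vX|[y ->]].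
  have Xt : [seq X i | i : 'I_m] = [tuple X i | i < m] by [].
  rewrite Xt in vX; exists (\row_i coord [tuple X i | i < m] i v); rewrite E.
  rewrite {1}(coord_span vX); apply: eq_bigr => i _.
  by rewrite mxE -tnth_nth tnth_mktuple.
rewrite E memv_suml// => i _; rewrite memvZ// memv_span//.
by apply/mapP; exists i; rewrite ?mem_enum.
Qed.

Lemma represents_memP k (A : 'M[R]_(k, n.+1)) (V : {vspace 'rV[R]_n.+1}) v :
  represents A V -> v \in V <-> exists y : 'rV[R]_k, v = y *m A.
Proof.
move=> [_ ->]; rewrite span_familyP; split=> -[y ->]; exists y; congr (_ *m _);
by apply/row_matrixP => i; rewrite rowK.
Qed.

Lemma represents_orthP k (A : 'M[R]_(k, n.+1)) (V : {vspace 'rV[R]_n.+1}) v :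
  represents A V -> v \in orthv V <-> A *m v^T = 0.
Proof.
move=> AV; have dotE u : dotv u v = (u *m v^T) 0 0.
  by rewrite mxE; apply: eq_bigr => i _; rewrite mxE.
split=> [/orthvP vV|Av].
  apply/row_matrixP => i; rewrite row_mul row0; apply/rowP => j.
  rewrite (ord1 j) -dotE mxE; apply: vV; apply/(represents_memP _ AV).
  by exists (delta_mx 0 i); rewrite rowE.
apply/orthvP => u /(represents_memP _ AV)[y ->].
by rewrite dotE -mulmxA Av mulmx0 mxE.
Qed.

Lemma TP_TNN k (A : 'M[R]_(k, n.+1)) : TP A -> TNN A.
Proof. by move=> tpA f /tpA/ltW. Qed.

End RowSpan.

(** * The affine slice of [W] and the meaning of positive orientation *)

Section Setting.
Variables (R : realType) (n k : nat) (W : {vspace 'rV[R]_n.+1}).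
Variable w : 'I_k.+1 -> 'rV[R]_n.+1.
Hypotheses (hW : Gr_pos k.+1 W) (hw : basis_of W (codom w)).
Hypotheses (hV : Gr_pos k (dirspan w)).
Hypothesis (hw0 : positively_oriented (dirspan w) (w ord0)).
Local Notation V := (dirspan w).
Implicit Types (x : 'rV[R]_k) (v z : 'rV[R]_n.+1).

Definition dirmx : 'M[R]_(k, n.+1) := \matrix_i w (lift ord0 i).
Definition basismx : 'M[R]_(k.+1, n.+1) := \matrix_i w i.

Lemma affcombE x : affcomb w x = w ord0 + x *m dirmx.
Proof.
rewrite addrC /affcomb mulmx_sum_row; congr (_ + _).
by apply: eq_bigr => i _; rewrite rowK.
Qed.

Lemma dirspanP v : v \in V <-> exists x, v = x *m dirmx.
Proof. exact: span_familyP. Qed.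

Lemma memWP v : v \in W <-> exists y : 'rV[R]_k.+1, v = y *m basismx.
Proof. by rewrite -(span_basis hw); exact: span_familyP. Qed.

Lemma mul_basismx (y : 'rV[R]_k.+1) : y *m basismx =
  y 0 ord0 *: w ord0 + (\row_i y 0 (lift ord0 i)) *m dirmx.
Proof.
rewrite !mulmx_sum_row big_ord_recl rowK; congr (_ + _).
by apply: eq_bigr => i _; rewrite !rowK mxE.
Qed.

Lemma basismx_free : row_free basismx.
Proof.
apply: inj_row_free => y y0; apply/rowP => i; rewrite mxE.
have fX : free [tuple w i | i < k.+1] by exact: (basis_free hw).
move/freeP: fX => fX; apply: (fX (fun i => y 0 i)).
rewrite -[RHS]y0 mulmx_sum_row; apply: eq_bigr => j _.
by rewrite rowK -tnth_nth tnth_mktuple.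
Qed.

Lemma memW v : v \in W -> exists c x, v = c *: w ord0 + x *m dirmx.
Proof. by move=> /memWP[y ->]; rewrite mul_basismx; do 2 eexists. Qed.

Definition homog (c : R) x : 'rV[R]_k.+1 :=
  \row_j if unlift ord0 j is Some i then x 0 i else c.

Lemma mul_homog c x : homog c x *m basismx = c *: w ord0 + x *m dirmx.
Proof.
rewrite mul_basismx mxE unlift_none; congr (_ + mulmx _ _).
by apply/rowP => i; rewrite !mxE liftK.
Qed.

Lemma affcomb_basismx x : affcomb w x = homog 1 x *m basismx.
Proof. by rewrite mul_homog scale1r affcombE. Qed.

Lemma affcombW x : affcomb w x \in W.
Proof. by apply/memWP; exists (homog 1 x); rewrite affcomb_basismx. Qed.

Lemma scale_affcomb c x : c *: affcomb w x = c *: w ord0 + (c *: x) *m dirmx.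
Proof. by rewrite affcombE scalerDr scalemxAl. Qed.

Lemma comb_eq0 c x : c *: w ord0 + x *m dirmx = 0 -> c = 0 /\ x = 0.
Proof.
rewrite -mul_homog -[RHS](mul0mx _ basismx) => /(row_free_inj basismx_free)/rowP E.
split; first by have := E ord0; rewrite !mxE unlift_none.
by apply/rowP => i; have := E (lift ord0 i); rewrite !mxE liftK.
Qed.

Lemma affcomb_neq0 x : affcomb w x != 0.
Proof.
apply/eqP; rewrite affcombE -[w ord0]scale1r => /comb_eq0[/eqP].
by rewrite oner_eq0.
Qed.

Lemma dirmx_inj x : x *m dirmx = 0 -> x = 0.
Proof. by move=> E; have [|] := @comb_eq0 0 x; rewrite ?scale0r ?add0r. Qed.

Lemma scale_of_memW z : z \in W -> z \notin V ->
  exists c x, c != 0 /\ z = c *: affcomb w x.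
Proof.
move=> /memW[c [x zE]] zV; have c0 : c != 0.
  apply: contraNneq zV => c0; apply/dirspanP; exists x.
  by rewrite zE c0 scale0r add0r.
by exists c, (c^-1 *: x); split=> //; rewrite scale_affcomb scalerA divff// scale1r.
Qed.

Lemma W_wtot_le v e : v \in W -> v != 0 -> (wtot e (sign v) <= k.+1)%N.
Proof.
case: hW => A AW tpA /(represents_memP _ AW)[y ->] v0.
by apply: TP_wtot_le => //; apply: contraNneq v0 => ->; rewrite mul0mx.
Qed.

Lemma V_wtot_le v e : v \in V -> v != 0 -> (wtot e (sign v) <= k)%N.
Proof.
case: hV => A AW tpA /(represents_memP _ AW)[y ->] v0.
by apply: TP_wtot_le => //; apply: contraNneq v0 => ->; rewrite mul0mx.
Qed.

Lemma dirspan_subW v : v \in V -> v \in W.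
Proof.
move=> /dirspanP[x ->]; rewrite (_ : x *m dirmx = affcomb w x - affcomb w 0).
  by rewrite rpredB ?affcombW.
by rewrite !affcombE mul0mx addr0 addrAC subrr add0r.
Qed.

Lemma not_dirspan v : v \in W -> v != 0 -> ovar (sign v) = k%:Z -> v \notin V.
Proof.
move=> vW v0 vk; apply/negP => vV.
have [e [ek _]] := ovar_wtot (sign_neq0 v0) vk.
by have := V_wtot_le e vV v0; rewrite ek ltnn.
Qed.

(** Adding vectors of [V] to the first row changes no minor. Writing the matrix as [P *m A] with [A]
    positive for [W], all its maximal minors have the sign of [\det P], which can be tested on the
    projection [u] of [w ord0]: being orthogonal to [V], it has a weak alternation of length
    [k + 1], starting with + because [u 0 ord0 > 0]. *)
Lemma orientation (B : 'M[R]_(k, n.+1)) (g : 'I_k.+1 -> 'I_n.+1) x :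
  represents B V -> TP B -> increasing g ->
  \det (colsub g (col_mx (affcomb w x) B) : 'M[R]_(k.+1)) =
    \det (colsub g (col_mx (w ord0) B) : 'M[R]_(k.+1)) /\
  0 < \det (colsub g (col_mx (w ord0) B) : 'M[R]_(k.+1)).
Proof.
move=> BV tpB hg.
have shift (h : 'I_k.+1 -> 'I_n.+1) z : z - w ord0 \in V ->
    \det (colsub h (col_mx z B) : 'M[R]_(k.+1)) =
    \det (colsub h (col_mx (w ord0) B) : 'M[R]_(k.+1)).
  move=> /(represents_memP _ BV)[y yE].
  have -> : z = w ord0 + y *m B by rewrite -yE addrC subrK.
  have := det_colsub_col_mx_mul y B h; rewrite !det_colsub_col_mx => y0.
  under eq_bigr do rewrite mxE mulrDr mulrDl.
  by rewrite big_split /= y0 addr0.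
split; first by apply: shift; rewrite affcombE addrAC subrr add0r; apply/dirspanP; exists x.
have [A AW tpA] := hW.
have mem0 : w ord0 \in W by rewrite -[w ord0](_ : affcomb w 0 = _) ?affcombW// affcombE mul0mx addr0.
have [P PE] : exists P : 'M[R]_(k.+1), (col_mx (w ord0) B : 'M[R]_(k.+1, n.+1)) = P *m A.
  have sub : (col_mx (w ord0) B <= A)%MS.
    rewrite col_mx_sub; apply/andP; split.
      by have /(represents_memP _ AW)[y ->] := mem0; rewrite submxMl.
    apply/row_subP => i.
    have /(represents_memP _ AW)[y ->] : row i B \in W; last by rewrite submxMl.
    by apply: dirspan_subW; apply/(represents_memP _ BV); exists (delta_mx 0 i); rewrite rowE.
  by exists (col_mx (w ord0) B *m pinvmx A); rewrite mulmxKpV.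
have detE (h : 'I_k.+1 -> 'I_n.+1) : \det (colsub h (col_mx (w ord0) B) : 'M[R]_(k.+1)) =
    \det P * \det (colsub h A) by rewrite -det_mulmx -colsub_mul -PE.
suff P0 : 0 < \det P by rewrite detE mulr_gt0// tpA.
have [u [/memv_capP[uV uW] wu u0]] := hw0.
have un : u != 0 by apply: contraTneq u0 => ->; rewrite mxE ltxx.
have [e ek] := TNN_orth BV.1 (TP_TNN tpB) un ((represents_orthP u BV).1 uV).
have diff : wtot false (sign u) = (wtot true (sign u)).+1.
  apply: (@wcount_first false _ 0)%N => //; rewrite letter_sign /sgn_of.
  by rewrite (_ : inord 0 = ord0) ?gt_eqF ?u0//; apply: val_inj; rewrite /= inordK.
have {}ek : (k.+1 <= wtot false (sign u))%N by case: e ek; rewrite diff; lia.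
have [h hh /(_ u erefl) alt] := wtot_alternate R ek.
have [ge le] := alternate_det_ge0 tpB hh alt.
have hE : \det (colsub h (col_mx u B) : 'M[R]_(k.+1)) = \det P * \det (colsub h A).
  by rewrite -detE shift// -[u - _]opprB rpredN.
move: ge le; rewrite expr0 mul1r hE => ge le.
(* If this minor were 0, its termwise bounds would make [u] vanish at [k + 1] positions, impossible
   for a nonzero vector of [W]. *)
rewrite -(pmulr_lgt0 _ (tpA _ hh)) lt_neqAle ge andbT eq_sym; apply/eqP => D0.
have uWW : u \in W.
  by rewrite -[u](subrK (w ord0)) rpredD// dirspan_subW// -[u - _]opprB rpredN.
have /(represents_memP _ AW)[y yE] := uWW.
case/eqP: un; rewrite yE (TP_inj tpA hh (y := y)) ?mul0mx// => j; rewrite -yE.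
have := le j; rewrite D0 pmulr_lle0 ?normr_le0 => [/eqP//|].
by apply: tpB; apply: increasing_lift.
Qed.

(** An alternation of length [k + 1] starting with [(-1)^e] makes [(-1)^e] times a positive minor
    nonnegative, so [e] is [false]. *)
Lemma affcomb_wtot x : ovar (psi w x) = k%:Z ->
  wtot false (psi w x) = k.+1 /\ wtot true (psi w x) = k.
Proof.
move=> xk; have [e [ek ek']] := ovar_wtot (sign_neq0 (affcomb_neq0 x)) xk.
have [B BV tpB] := hV.
have [g hg /(_ _ erefl) alt] := wtot_alternate R (eq_leq (esym ek)).
have [ge _] := alternate_det_ge0 tpB hg alt.
have [dE d0] := orientation x BV tpB hg; move: ge; rewrite dE.
by case: e ek ek' {alt} => // _ _; rewrite expr1 mulN1r oppr_ge0 leNgt d0.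
Qed.

Lemma psi_ovar_or x : ovar (psi w x) = k%:Z \/ forall e, (wtot e (psi w x) <= k)%N.
Proof.
have [/existsP[e ek]|/existsPn H] := boolP [exists e, (k < wtot e (psi w x))%N].
  by left; apply: wtot_ovar ek => d; apply: W_wtot_le; rewrite ?affcombW ?affcomb_neq0.
by right=> e; rewrite leqNgt H.
Qed.

End Setting.

(** * Entrywise limits of matrices and closures *)

Section RowTopology.
Variable R : realType.

Lemma cvg_sumr (T : Type) (F : set_system T) (FF : Filter F) (I : Type) (r : seq I)
    (f : I -> T -> R) (a : I -> R) :
  (forall i, f i t @[t --> F] --> a i) ->
  \sum_(i <- r) f i t @[t --> F] --> \sum_(i <- r) a i.
Proof.
move=> fa; elim: r => [|i r IH].
  by rewrite big_nil; under eq_cvg do rewrite big_nil; exact: cvg_cst.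
by rewrite big_cons; under eq_cvg do rewrite big_cons; exact: cvgD.
Qed.

Lemma mx_cvg_entries (T : Type) (F : set_system T) (FF : Filter F) m p
    (f : T -> 'M[R]_(m, p)) (M : 'M[R]_(m, p)) :
  (forall i j, f t i j @[t --> F] --> M i j) -> f t @[t --> F] --> M.
Proof.
move=> fM A [P PM PA].
have H : F (fun t => forall ij : 'I_m * 'I_p, P ij.1 ij.2 (f t ij.1 ij.2)).
  by apply: filter_forall => -[i j] /=; exact: (fM i j _ (PM i j)).
suff : F (f @^-1` A) by [].
move: H; apply: filterS => t Pt.
by apply: PA => i j; exact: (Pt (i, j)).
Qed.

Lemma mulmxr_cvg (T : Type) (F : set_system T) (FF : Filter F) m p q
    (f : T -> 'M[R]_(m, p)) (M : 'M[R]_(m, p)) (N : 'M[R]_(p, q)) :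
  f t @[t --> F] --> M -> f t *m N @[t --> F] --> M *m N.
Proof.
move=> fM; apply: mx_cvg_entries => i j; rewrite mxE; under eq_cvg do rewrite mxE.
apply: cvg_sumr => l; apply: cvgMr_tmp.
exact: (cvg_comp f (fun M' : 'M[R]_(m, p) => M' i l) fM (@coord_continuous R m p i l M)).
Qed.

Lemma mx_norm_le m p (M : 'M[R]_(m, p)) (c : R) : 0 <= c ->
  (forall i j, `|M i j| <= c) -> `|M| <= c.
Proof.
move=> c0 Mc; rewrite [leLHS]/Num.norm /= mx_normrE; apply/bigmax_leP.
by split=> // -[i j] _; exact: Mc.
Qed.

Lemma closure_image (T U : topologicalType) (f : T -> U) (G : set T) x :
  {for x, continuous f} -> closure G x -> closure (f @` G) (f x).
Proof.
by move=> fx Gx B /fx /Gx[y [Gy By]]; exists (f y); split.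
Qed.

Lemma closure_sub_iff (T : topologicalType) (F G : set T) :
  closure F `<=` closure G <-> F `<=` closure G.
Proof.
split=> [FG x Fx|FG]; first exact/FG/subset_closure.
by have /closure_id -> := @closed_closure _ G; exact: closure_subset.
Qed.

End RowTopology.

(** * Lines, their spanning vectors and rescaling of signs *)

Section Lines.
Variables (R : realType) (n : nat).
Implicit Types (v z : 'rV[R]_n.+1) (L : projsp R n).

Lemma vline_scale (c : R) v : c != 0 -> <[c *: v]>%VS = <[v]>%VS.
Proof.
move=> c0; apply/eqP; rewrite eqEsubv; apply/andP; split.
  by rewrite -memvE; apply/vlineP; exists c.
by rewrite -memvE; apply/vlineP; exists c^-1; rewrite scalerA mulVf// scale1r.
Qed.

Lemma projsp_line L v : val L = <[v]>%VS -> v != 0.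
Proof.
by move=> Lv; apply/eqP => v0; have := valP L; rewrite Lv v0 dim_vline eqxx.
Qed.

Lemma vpick_line L v : val L = <[v]>%VS -> exists2 c, c != 0 & vpick (val L) = c *: v.
Proof.
move=> Lv; have := memv_pick (val L); rewrite {2}Lv => /vlineP[c E]; exists c => //.
apply/eqP => c0; have := vpick0 (val L); rewrite E c0 scale0r eqxx => /esym/eqP L0.
by have := valP L; rewrite L0 dimv0.
Qed.

Lemma val_vpick L : val L = <[vpick (val L)]>%VS.
Proof.
apply/eqP; rewrite eq_sym eqEdim -memvE memv_pick /= (eqP (valP L)) dim_vline.
by rewrite vpick0 -dimv_eq0 (eqP (valP L)).
Qed.

Lemma sign_scale (c : R) v : c != 0 ->
  sign (c *: v) = sign v \/ sign (c *: v) = signvec_opp (sign v).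
Proof.
move=> c0; case: (ltgtP c 0) => [cn|cp|/eqP]; last by rewrite (negbTE c0).
  right; apply/ffunP => i; rewrite !ffunE mxE -[c]opprK mulNr sgn_ofN sgn_ofM//.
  by rewrite oppr_gt0.
by left; apply/ffunP => i; rewrite !ffunE mxE sgn_ofM.
Qed.

Lemma ovar_scale (c : R) v : c != 0 -> ovar (sign (c *: v)) = ovar (sign v).
Proof. by move=> /(sign_scale v)[->|->]; rewrite ?ovar_opp. Qed.

Lemma sgn_of_addM (t a b : R) : 0 <= t -> sgn_of b = sgn_of a ->
  sgn_of (a + t * b) = sgn_of a.
Proof.
move=> t0; rewrite /sgn_of; case: (ltgtP a 0) => a0; case: (ltgtP b 0) => // b0 _.
- have : a + t * b < 0 by have : t * b <= 0; [rewrite mulr_ge0_le0// ltW|lra].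
  by case: ltgtP.
- have : 0 < a + t * b by have : 0 <= t * b; [rewrite mulr_ge0// ltW|lra].
  by case: ltgtP.
- by rewrite a0 b0 mulr0 addr0 eqxx.
Qed.

Lemma signvec_oppK (s : signvec n.+1) : signvec_opp (signvec_opp s) = s.
Proof. by apply/ffunP => i; rewrite !ffunE; case: (s i). Qed.

Lemma stratum_opp (W : {vspace 'rV[R]_n.+1}) s : stratum W (signvec_opp s) = stratum W s.
Proof.
by apply/seteqP; split=> L /= -[v [vW v0 vs Lv]]; exists v; split=> //; move: vs;
  rewrite signvec_oppK => -[]; [right|left|right|left].
Qed.

End Lines.

(** * Bounded faces and the points of the amplituhedron *)

Section BoundedFaces.
Variables (R : realType) (n k : nat) (W : {vspace 'rV[R]_n.+1}).
Variable w : 'I_k.+1 -> 'rV[R]_n.+1.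
Hypotheses (hW : Gr_pos k.+1 W) (hw : basis_of W (codom w)).
Hypotheses (hV : Gr_pos k (dirspan w)).
Hypothesis (hw0 : positively_oriented (dirspan w) (w ord0)).
Local Notation V := (dirspan w).
Implicit Types (x : 'rV[R]_k) (v z : 'rV[R]_n.+1).

Lemma bounded_face s x0 : psi w x0 = s -> ovar s = k%:Z -> bounded_set (face w s).
Proof.
move=> x0s sk; have [sf _] : wtot false s = k.+1 /\ wtot true s = k.
  by rewrite -x0s; apply: (affcomb_wtot hW hw hV hw0); rewrite x0s.
have [B BV tpB] := hV.
have [g hg alt] := wtot_alternate R (eq_leq (esym sf)).
pose D := \det (colsub g (col_mx (w ord0) B) : 'M[R]_(k.+1)).
(* Bounding [k] of the entries suffices: the corresponding columns of [dirmx w] are invertible, so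
   these entries determine [x]. *)
pose f := g \o lift ord0; have hf : increasing f by apply: increasing_lift.
have fu : colsub f (dirmx w) \in unitmx.
  rewrite -row_free_unit; apply: inj_row_free => y y0.
  apply: (dirmx_inj hw).
  have /(represents_memP _ BV)[y' E] : y *m dirmx w \in V by apply/dirspanP; exists y.
  rewrite E (TP_inj tpB hf (y := y')) ?mul0mx// => j; rewrite -E.
  by move: y0; rewrite -colsub_mul => /rowP/(_ j); rewrite [LHS]mxE [RHS]mxE.
(* The first term bounds the entry of [affcomb w x], as [D] does not depend on [x]; the second
   accounts for subtracting [w ord0]. *)
pose b (j : 'I_k) := D / \det (colsub (g \o lift (lift ord0 j)) B) + `|w ord0 0 (f j)|.
pose K := \sum_(i < k) \sum_(j < k) b j * `|invmx (colsub f (dirmx w)) j i|.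
have b0 x j : face w s x -> `|affcomb w x 0 (f j) - w ord0 0 (f j)| <= b j.
  move=> xs; have [_ /(_ (lift ord0 j)) H] := alternate_det_ge0 tpB hg (alt _ xs).
  have [dE d0] := orientation hW hw hw0 x BV tpB hg.
  move: H; rewrite dE expr0 mul1r -/D -ler_pdivlMr; last first.
    by apply: tpB; apply: increasing_lift.
  by move=> H; apply: le_trans (ler_normB _ _) _; rewrite lerD.
have xK x : face w s x -> forall i, `|x 0 i| <= K.
  move=> xs i.
  have bge j : 0 <= b j by apply: le_trans (b0 x j xs).
  have xE : x = (x *m colsub f (dirmx w)) *m invmx (colsub f (dirmx w)) by rewrite mulmxK.
  have le1 : `|x 0 i| <= \sum_(j < k) b j * `|invmx (colsub f (dirmx w)) j i|.
    rewrite {1}xE mxE; apply: le_trans (ler_norm_sum _ _ _) _; apply: ler_sum => j _.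
    rewrite normrM ler_wpM2r//; apply: le_trans (b0 x j xs).
    by rewrite -colsub_mul mxE affcombE [X in X - _]mxE addrAC subrr add0r.
  apply: le_trans le1 _; rewrite /K [leRHS](bigD1 i)//= lerDl sumr_ge0// => i' _.
  by rewrite sumr_ge0// => j _; rewrite mulr_ge0.
exists `|K|; split; first exact: num_real.
move=> M KM x xs /=; apply: mx_norm_le => [|i j].
  by apply: ltW; apply: le_lt_trans KM.
rewrite (ord1 i); apply: le_trans (xK _ xs j) _; apply: ltW.
by apply: le_lt_trans KM; exact: ler_norm.
Qed.

Lemma leq_dim : (k <= n.+1)%N.
Proof. by have [A [/eqP Af _] _] := hV; rewrite -Af rank_leq_col. Qed.

(** Some vector of [V] has the signs of [affcomb w x]; moving along it keeps all signs, so the face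
    contains a ray. *)
Lemma unbounded_face x : (forall e, wtot e (psi w x) <= k)%N ->
  ~ bounded_set (face w (psi w x)).
Proof.
move=> xk; have [B BV tpB] := hV.
have [y yE] := TP_sign_realize tpB leq_dim (sign_neq0 (affcomb_neq0 hw x)) xk.
have /dirspanP[x1 x1E] : y *m B \in V by apply/(represents_memP _ BV); exists y.
have x1n : x1 != 0.
  apply/eqP => x10; apply: (sign_neq0 (affcomb_neq0 hw x)); rewrite -yE x1E x10.
  by apply/ffunP => i; rewrite mul0mx !ffunE mxE /sgn_of eqxx.
have inF t : 0 <= t -> face w (psi w x) (x + t *: x1).
  move=> t0; rewrite /face /= /psi affcombE mulmxDl addrA -affcombE -scalemxAl -x1E.
  apply/ffunP => i; move/ffunP: yE => /(_ i); rewrite !ffunE => yE.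
  by rewrite [X in sgn_of X]mxE [X in _ + X]mxE sgn_of_addM.
move=> [M [_ /(_ (`|M| + 1))]]; rewrite ltr_pwDr ?ler_norm// => /(_ isT) bd.
(* Chosen so that the norm of [t *: x1] exceeds the supposed bound [|M| + 1] plus the norm of
   [x]. *)
pose t := (`|M| + 1 + `|x| + 1) / `|x1|.
have x1p : 0 < `|x1| by rewrite normr_gt0.
have t0 : 0 <= t by rewrite divr_ge0// !addr_ge0.
have := bd _ (inF _ t0); rewrite /=.
have : `|t *: x1| <= `|x + t *: x1| + `|x|.
  by rewrite -{1}[t *: x1](addKr x) addrC; apply: le_trans (ler_normB _ _) _.
rewrite normrZ (ger0_norm t0) /t divfK ?gt_eqF//; lra.
Qed.

Lemma bounded_faceP x : bounded_set (face w (psi w x)) <-> ovar (psi w x) = k%:Z.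
Proof.
split=> [bd|xk]; last exact: (bounded_face erefl).
by have [//|/unbounded_face] := psi_ovar_or hW hw x.
Qed.

Lemma bounded_complexP x : bounded_complex w x <-> ovar (psi w x) = k%:Z.
Proof.
split=> [[_ [[s ->] _ bd] xs]|xk].
  by apply/bounded_faceP; move: xs; rewrite /face /= => ->.
exists (face w (psi w x)) => //; split; first by exists (psi w x).
  by exists x.
exact/bounded_faceP.
Qed.

Lemma amplituhedronP L : amplituhedron k W L <->
  exists2 x, ovar (psi w x) = k%:Z & L = Psi w x.
Proof.
split=> [[V' [A AV nnA] LV]|[x xk ->]].
  have [v Lv] : exists v, val L = <[v]>%VS by exists (vpick (val L)); exact: val_vpick.
  have v0 := projsp_line Lv.
  have : v \in val L by rewrite Lv memv_line.
  rewrite LV => /memv_capP[/(represents_orthP _ AV) Av vW].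
  have [e ek] := TNN_orth AV.1 nnA v0 Av.
  have vk : ovar (sign v) = k%:Z.
    by apply: wtot_ovar ek => d; exact: (W_wtot_le hW).
  have [c [x [c0 vE]]] := scale_of_memW hw vW (not_dirspan hV vW v0 vk).
  exists x; first by rewrite -vk vE ovar_scale.
  by apply: val_inj; rewrite /= /Psi val_line ?(affcomb_neq0 hw)// Lv vE vline_scale.
have z0 := affcomb_neq0 hw x; set z := affcomb w x in z0.
have zW : z \in W := affcombW hw x.
have [e [ek _]] := ovar_wtot (sign_neq0 z0) xk.
have [A [Af nnA Az]] := exists_TNN_orth (eq_leq (esym ek)).
pose V' : {vspace 'rV[R]_n.+1} := <<[seq row i A | i : 'I_k]>>%VS.
have AV : represents A V' by [].
exists V'; first by exists A.
rewrite /= /Psi val_line//; apply/eqP; rewrite eqEsubv; apply/andP; split.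
  by rewrite -memvE memv_cap zW andbT; apply/(represents_orthP _ AV).
apply/subvP => y /memv_capP[/(represents_orthP _ AV) Ay yW].
have [c [x' yE]] := memW hw yW.
(* The intersection is no larger than the line of [z]: this difference lies in [V] and is orthogonal
   to [V'], so if nonzero its variation would be both below [k] and at least [k]. *)
have yc : y - c *: z \in V.
  apply/dirspanP; exists (x' - c *: x).
  by rewrite yE /z scale_affcomb opprD addrACA subrr add0r mulmxBl.
have [yc0|yc0] := eqVneq (y - c *: z) 0.
  by apply/vlineP; exists c; apply/eqP; rewrite -subr_eq0 yc0.
have [|e' ek'] := TNN_orth Af nnA yc0.
  by rewrite linearB linearZ /= mulmxBr -scalemxAr Ay Az scaler0 subr0.
by have := V_wtot_le hV e' yc yc0; rewrite leqNgt ek'.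
Qed.

End BoundedFaces.

(** * The inverse chart, the homeomorphism and the matching of strata *)

Section Homeo.
Variables (R : realType) (n k : nat) (W : {vspace 'rV[R]_n.+1}).
Variable w : 'I_k.+1 -> 'rV[R]_n.+1.
Hypotheses (hW : Gr_pos k.+1 W) (hw : basis_of W (codom w)).
Hypotheses (hV : Gr_pos k (dirspan w)).
Hypothesis (hw0 : positively_oriented (dirspan w) (w ord0)).
Implicit Types (x : 'rV[R]_k) (v z : 'rV[R]_n.+1) (L : projsp R n).

(** Coordinates in the basis [w], extended linearly from [W] to all vectors; the inverse map is thus
    defined on a full neighbourhood of each image point. *)
Definition coords v : 'rV[R]_k.+1 := v *m pinvmx (basismx w).

Definition chart v : 'rV[R]_k :=
  \row_i (coords v 0 (lift ord0 i) / coords v 0 ord0).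

Definition Psi_inv L : 'rV[R]_k := chart (vpick (val L)).

Lemma coords_affcomb x : coords (affcomb w x) = homog 1 x.
Proof. by rewrite /coords affcomb_basismx (mulmxKp (basismx_free hw)). Qed.

Lemma chart_affcomb x : chart (affcomb w x) = x.
Proof.
by apply/rowP => i; rewrite mxE coords_affcomb !mxE liftK unlift_none divr1.
Qed.

Lemma coords_scale (c : R) v i : coords (c *: v) 0 i = c * coords v 0 i.
Proof. by rewrite /coords -scalemxAl mxE. Qed.

Lemma chart_scale (c : R) v : c != 0 -> chart (c *: v) = chart v.
Proof.
move=> c0; apply/rowP => i; rewrite [LHS]mxE [RHS]mxE !coords_scale.
by rewrite -mulf_div divff// mul1r.
Qed.

Lemma Psi_inv_line L v : val L = <[v]>%VS -> Psi_inv L = chart v.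
Proof. by move=> /vpick_line[c c0 E]; rewrite /Psi_inv E chart_scale. Qed.

Lemma val_Psi x : val (Psi w x) = <[affcomb w x]>%VS.
Proof. by rewrite /Psi val_line// (affcomb_neq0 hw). Qed.

Lemma PsiK : cancel (Psi w) Psi_inv.
Proof. by move=> x; rewrite (Psi_inv_line (val_Psi x)) chart_affcomb. Qed.

Lemma affcomb_cvg (T : Type) (F : set_system T) (FF : Filter F) (f : T -> 'rV[R]_k) x :
  f t @[t --> F] --> x -> affcomb w (f t) @[t --> F] --> affcomb w x.
Proof.
move=> fx; rewrite affcombE; under eq_cvg do rewrite affcombE.
by apply: cvgD; [exact: cvg_cst|exact: mulmxr_cvg].
Qed.

Lemma Psi_continuous : continuous (Psi w).
Proof.
apply/continuousP => U oU.
have aff_cont : continuous (affcomb w).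
  move=> x; exact: (affcomb_cvg (nbhs_filter x) (f := id) cvg_id).
have := open_comp (fun x _ => aff_cont x) (oU : open (cone U)).
congr open; apply/seteqP; split=> x /=.
  by move=> [L UL Lx]; rewrite (_ : Psi w x = L)//; apply: val_inj; rewrite Lx val_Psi.
by move=> Ux; exists (Psi w x) => //; rewrite val_Psi.
Qed.

Lemma coords_cvg v i : coords u 0 i @[u --> v] --> coords v 0 i.
Proof.
have H : coords u @[u --> v] --> coords v.
  exact: (@mulmxr_cvg R _ (nbhs v) (nbhs_filter v) 1 n.+1 k.+1 id v _ cvg_id).
exact: (cvg_comp coords (fun M' : 'rV[R]_k.+1 => M' 0 i) H (@coord_continuous R 1 k.+1 0 i (coords v))).
Qed.

Lemma chart_cvg v : coords v 0 ord0 != 0 -> chart u @[u --> v] --> chart v.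
Proof.
move=> v0; apply: (mx_cvg_entries (nbhs_filter v)) => i j; rewrite mxE.
under eq_cvg do rewrite mxE.
apply: (cvgM (FF := nbhs_filter v)); first exact: coords_cvg.
by apply: (cvgV (FF := nbhs_filter v)) => //; exact: coords_cvg.
Qed.

Lemma Psi_inv_continuous L v : val L = <[v]>%VS -> coords v 0 ord0 != 0 ->
  {for L, continuous Psi_inv}.
Proof.
move=> Lv v0 A; rewrite (Psi_inv_line Lv) nbhsE => -[Q [oQ Qv] QA].
(* Only lines with nonzero coordinate along [w ord0] are kept: there [chart] is continuous, which
   makes the cone over [U] open. *)
pose U : set (projsp R n) :=
  [set L' | coords (vpick (val L')) 0 ord0 != 0 /\ Q (Psi_inv L')].
have UE L' v' : val L' = <[v']>%VS -> U L' <-> (coords v' 0 ord0 != 0 /\ Q (chart v')).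
  move=> Lv'; rewrite /U /= (Psi_inv_line Lv').
  by have [c c0 ->] := vpick_line Lv'; rewrite coords_scale mulf_eq0 (negbTE c0).
suff oU : open U.
  rewrite /= /nbhs_filterE; apply: (@filterS _ _ _ U).
    by move=> L' [_ QL']; exact: QA.
  by apply: open_nbhs_nbhs; split=> //; apply/(UE _ _ Lv).
suff : open (cone U) by [].
have -> : cone U = [set v' | coords v' 0 ord0 != 0 /\ Q (chart v')].
  apply/seteqP; split=> v' /=; first by move=> [L' UL' Lv']; apply/(UE _ _ Lv').
  move=> H; have v'0 : v' != 0.
    by apply: contraTneq H.1 => ->; rewrite /coords mul0mx mxE eqxx.
  by exists (line v'); [apply/(UE _ _ (val_line v'0))|rewrite val_line].
rewrite openE => v' [v'0 Qv']; rewrite /interior.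
have n1 : nbhs v' [set u | coords u 0 ord0 != 0].
  apply: (@coords_cvg v' ord0 [set y | y != 0]).
  by apply: open_nbhs_nbhs; split=> //; exact: open_neq.
have n2 : nbhs v' [set u | Q (chart u)].
  by apply: (chart_cvg v'0); apply: open_nbhs_nbhs.
by apply: filterS (filterI n1 n2).
Qed.

Lemma Psi_inv_continuous_at x : {for Psi w x, continuous Psi_inv}.
Proof.
apply: (Psi_inv_continuous (val_Psi x)).
by rewrite coords_affcomb mxE unlift_none oner_eq0.
Qed.

Lemma psi_of_sign v s : v \in W -> v != 0 -> ovar s = k%:Z ->
  sign v = s \/ sign v = signvec_opp s ->
  exists x, [/\ ovar (psi w x) = k%:Z, psi w x = s \/ psi w x = signvec_opp s &
    <[v]>%VS = <[affcomb w x]>%VS].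
Proof.
move=> vW v0 sk vs.
have vk : ovar (sign v) = k%:Z by case: vs => ->; rewrite ?ovar_opp.
have [c [x [c0 vE]]] := scale_of_memW hw vW (not_dirspan hV vW v0 vk).
exists x; rewrite vE vline_scale//.
have E : affcomb w x = c^-1 *: v by rewrite vE scalerA mulVf// scale1r.
have ci : c^-1 != 0 by rewrite invr_eq0.
split=> //; first by rewrite /psi E ovar_scale.
by rewrite /psi E; have [->|->] := sign_scale v ci; case: vs => ->;
  rewrite ?signvec_oppK; [left|right|right|left].
Qed.

(** [W] is totally positive of dimension [k + 1], so it contains a vector with signs [s]; rescaling
    it into the affine slice may reverse all signs. *)
Lemma psi_realize s : s <> signvec0 n.+1 -> ovar s = k%:Z ->
  exists x, ovar (psi w x) = k%:Z /\ (psi w x = s \/ psi w x = signvec_opp s).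
Proof.
move=> s0 sk; have [A AW tpA] := hW.
have kn : (k.+1 <= n.+1)%N by rewrite -(eqP AW.1) rank_leq_col.
have [|y yE] := TP_sign_realize tpA kn s0.
  by move=> e; have [e' [H1 H2]] := ovar_wtot s0 sk; case: e e' H1 H2 => [] [] /=; lia.
have vW : y *m A \in W by apply/(represents_memP _ AW); exists y.
have v0 : y *m A != 0.
  apply/eqP => v0; apply: s0; rewrite -yE v0; apply/ffunP => i.
  by rewrite !ffunE mxE /sgn_of eqxx.
by have [x [xk xs _]] := psi_of_sign vW v0 sk (or_introl yE); exists x.
Qed.

Lemma psi_sign_unique x s : ovar (psi w x) = k%:Z -> wtot false s = k.+1 ->
  psi w x = s \/ psi w x = signvec_opp s -> psi w x = s.
Proof.
move=> xk sf [//|xs]; have [_] := affcomb_wtot hW hw hV hw0 xk.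
by rewrite xs wtot_opp /= sf => /eqP; rewrite eqn_leq ltnn.
Qed.

Lemma Psi_face s : ovar s = k%:Z -> wtot false s = k.+1 ->
  Psi w @` face w s = stratum W s.
Proof.
move=> sk sf; apply/seteqP; split=> L /=.
  move=> [x xs <-]; exists (affcomb w x); split.
  - exact: (affcombW hw).
  - exact: (affcomb_neq0 hw).
  - by left.
  - exact: val_Psi.
move=> [v [vW v0 vs Lv]]; have [x [xk xs vE]] := psi_of_sign vW v0 sk vs.
exists x; first exact: (psi_sign_unique xk sf xs).
by apply: val_inj; rewrite val_Psi -vE Lv.
Qed.

Lemma bounded_facesP F : bounded_faces w F <->
  exists x, ovar (psi w x) = k%:Z /\ F = face w (psi w x).
Proof.
split=> [[[s ->] [x xs] bd]|[x [xk ->]]].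
  have <- : psi w x = s by exact: xs.
  by exists x; split=> //; apply/(bounded_faceP hW hw hV hw0); rewrite xs.
split; [by exists (psi w x)|by exists x|].
exact/(bounded_faceP hW hw hV hw0).
Qed.

Lemma homeomorphism_Psi :
  homeomorphism_on (bounded_complex w) (amplituhedron k W) (Psi w).
Proof.
split.
- split=> [x /(bounded_complexP hW hw hV hw0) xk|x x' _ _ /(can_inj PsiK)//|L].
    by apply/(amplituhedronP hW hw hV); exists x.
  move=> /(amplituhedronP hW hw hV)[x xk ->]; exists x => //.
  exact/(bounded_complexP hW hw hV hw0).
- by apply: continuous_in_subspaceT => x _; exact: Psi_continuous.
- exists Psi_inv; last by move=> x _; exact: PsiK.
  apply: continuous_in_subspaceT => L; rewrite inE.
  by move=> /(amplituhedronP hW hw hV)[x _ ->]; exact: Psi_inv_continuous_at.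
Qed.

(** Closure containments pass to the images by continuity of [Psi w] and come back by continuity of
    [Psi_inv] at image points. *)
Lemma closure_poset_iso_Psi :
  closure_poset_iso (bounded_faces w) (strata k W) (fun F => Psi w @` F).
Proof.
have imK (F : set 'rV[R]_k) : Psi_inv @` (Psi w @` F) = F.
  apply/seteqP; split=> x /=; first by move=> [_ [y Fy <-] <-]; rewrite PsiK.
  by move=> Fx; exists (Psi w x); [exists x|exact: PsiK].
split; first split.
- move=> F /bounded_facesP[x [xk ->]]; exists (psi w x); split=> //.
    exact/sign_neq0/(affcomb_neq0 hw).
  by apply: Psi_face => //; exact: (affcomb_wtot hW hw hV hw0 xk).1.
- by move=> F G _ _ FG; rewrite -(imK F) -(imK G) FG.
- move=> S [s [s0 sk ->]]; have [x [xk xs]] := psi_realize s0 sk.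
  exists (face w (psi w x)); first by apply/bounded_facesP; exists x.
  rewrite Psi_face//; last exact: (affcomb_wtot hW hw hV hw0 xk).1.
  (* The stratum may be labeled by the opposite of the sign vector of its face; opposite labels give
     the same stratum. *)
  by case: xs => ->; rewrite ?stratum_opp.
move=> F G _ _; rewrite !closure_sub_iff; split=> [FG L [x Fx <-]|FG x Fx].
  by apply: closure_image; [exact: Psi_continuous|exact: FG].
rewrite -(PsiK x) -(imK G); apply: closure_image; first exact: Psi_inv_continuous_at.
by apply: FG; exists x.
Qed.

End Homeo.

Theorem theorem6p14 (R : realType) (n k : nat) (hk : (k < n.+1)%N)
    (W : {vspace 'rV[R]_n.+1}) (w : 'I_k.+1 -> 'rV[R]_n.+1)
    (hW : Gr_pos k.+1 W) (hw : basis_of W (codom w))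
    (hV : Gr_pos k (dirspan w))
    (hw0 : positively_oriented (dirspan w) (w ord0)) :
  [/\ homeomorphism_on (bounded_complex w) (amplituhedron k W) (Psi w),
      closure_poset_iso (bounded_faces w) (strata k W)
        (fun F => Psi w @` F) &
      forall s : signvec n.+1, Sign_bar k s ->
        bounded_faces w (face w s) /\ Psi w @` face w s = stratum W s].
Proof.
split; [exact: homeomorphism_Psi|exact: closure_poset_iso_Psi|].
move=> s sS; have [s0 sk _] := sS; have [sf _] := Sign_bar_wtot sS.
have [x [xk xs]] := psi_realize hW hw hV s0 sk.
have {}xs := psi_sign_unique hW hw hV hw0 xk sf xs.
split; last exact: (Psi_face hW hw hV hw0).
by apply/(bounded_facesP hW hw hV hw0); exists x; rewrite xs.
Qed.
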